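(* Let $r\ge3$, $d\ge 4$ and $m=d+2$. Then $$\rho\big(T^r_{(m,d)}(\lfloor d/2\rfloor+1)\big)>\rho\big(T^r_{(m,d)}(\lfloor d/2\rfloor)\big)>\cdots>\rho\big(T^r_{(m,d)}(3)\big),$$ and every supertree $\mathcal{T}\in S(m,d,r)$ not isomorphic to any of $T^r_{(m,d)}(3),\dots,T^r_{(m,d)}(\lfloor d/2\rfloor+1)$ satisfies $\rho(\mathcal{T})<\rho(T^r_{(m,d)}(3))$. That is, these $\lfloor d/2\rfloor-1$ supertrees attain, in this order, the first $\lfloor d/2\rfloor-1$ largest spectral radii in $S(m,d,r)$.
   Context: All hypergraphs are $r$-uniform (every edge has exactly $r$ vertices) and linear (two edges share at most one vertex). A path of length $\ell$ is an alternating sequence $v_1e_1v_2\cdots e_\ell v_{\ell+1}$ of distinct vertices and distinct edges with $v_i,v_{i+1}\in e_i$; a cycle is defined analogously as a closed such sequence with all vertices and edges distinct. A supertree is a connected hypergraph with no cycle. The distance between two vertices is the length of a shortest path joining them, and the diameter is the maximum distance. $S(m,d,r)$ is the set of $r$-uniform supertrees with $m$ edges and diameter $d$. The adjacency tensor $\mathcal{A}(\mathcal{H})$ of a hypergraph on $n$ vertices is the order-$r$, dimension-$n$ tensor with entry $1/(r-1)!$ at $(i_1,\dots,i_r)$ if $\{i_1,\dots,i_r\}$ is an edge and $0$ otherwise; $\lambda\in\mathbb{C}$ is an eigenvalue if $\mathcal{A}x=\lambda x^{[r-1]}$ for some nonzero $x\in\mathbb{C}^n$, where $(\mathcal{A}x)_i=\sum_{i_2,\dots,i_r}a_{ii_2\cdots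 i_r}x_{i_2}\cdots x_{i_r}$ and $(x^{[r-1]})_i=x_i^{r-1}$; $\rho(\mathcal{H})$ is the maximum modulus of the eigenvalues. For an ordinary graph $G$ and $r\ge3$, the $r$-th power $G^r$ is obtained by adding to each edge of $G$ $r-2$ new vertices (distinct for distinct edges). Let $P=(v_1,e_1,v_2,\dots,e_d,v_{d+1})$ be an ordinary path with $d$ edges; for $2\le i\le d$, $T_{(m,d)}(i)$ is the tree obtained from $P$ by attaching $m-d$ new pendent edges at $v_i$, and $T^r_{(m,d)}(i)$ is its $r$-th power. *)

(* Defs.v *)
From HB Require Import structures.
From mathcomp Require Import all_boot all_order all_algebra.
From mathcomp Require Import boolp classical_sets reals.
From mathcomp Require Import complex.

Set Implicit Arguments.
Unset Strict Implicit.
Unset Printing Implicit Defensive.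

Import Order.TTheory GRing.Theory Num.Theory.

Local Open Scope ring_scope.
Local Open Scope complex_scope.

Record hypergraph := Hypergraph {
  vert :> finType;
  edges : {set {set vert}} }.

Definition uniform (r : nat) (H : hypergraph) : Prop :=
  forall e, e \in edges H -> #|e| = r.

Definition linear_hg (H : hypergraph) : Prop :=
  forall e f, e \in edges H -> f \in edges H -> e != f -> (#|e :&: f| <= 1)%N.

(* The alternating sequence v_1 e_1 v_2 ... e_l v_(l+1) is encoded by its
   first vertex x = v_1 and the list s = [:: (e_1, v_2); ...; (e_l, v_(l+1))];
   its length l is size s. *)
Fixpoint walk (H : hypergraph) (x : H) (s : seq ({set H} * H)) : bool :=
  if s is (e, y) :: s' then
    [&& e \in edges H, x \in e, y \in e & walk y s']
  else true.

Definition walk_end (H : hypergraph) (x : H) (s : seq ({set H} * H)) : H :=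
  last x (unzip2 s).

Definition is_path (H : hypergraph) (x : H) (s : seq ({set H} * H)) : bool :=
  [&& walk x s, uniq (x :: unzip2 s) & uniq (unzip1 s)].

(* The vertex x of a closed sequence occurs once in unzip2 s, as its last
   entry.  The degenerate sequence x e x is not a cycle. *)
Definition is_cycle (H : hypergraph) (x : H) (s : seq ({set H} * H)) : bool :=
  [&& walk x s, walk_end x s == x, (2 <= size s)%N,
      uniq (unzip2 s) & uniq (unzip1 s)].

Definition connected_hg (H : hypergraph) : Prop :=
  forall x y : H, exists2 s, is_path x s & walk_end x s = y.

Definition supertree (H : hypergraph) : Prop :=
  connected_hg H /\ (forall (x : H) s, ~~ is_cycle x s).

Definition is_distance (H : hypergraph) (x y : H) (k : nat) : Prop :=
  (exists s, [/\ is_path x s, walk_end x s = y & size s = k]) /\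
  (forall s, is_path x s -> walk_end x s = y -> (k <= size s)%N).

Definition is_diameter (H : hypergraph) (d : nat) : Prop :=
  (exists x y : H, is_distance x y d) /\
  (forall (x y : H) k, is_distance x y k -> (k <= d)%N).

(* in_S m d r H states that H belongs to S(m,d,r). *)
Definition in_S (m d r : nat) (H : hypergraph) : Prop :=
  [/\ uniform r H, linear_hg H, supertree H, #|edges H| = m
    & is_diameter H d].

Definition isomorphic (H K : hypergraph) : Prop :=
  exists2 f : H -> K, bijective f &
    forall e : {set H}, (f @: e \in edges K) = (e \in edges H).

(* The entry of the order-r tensor at (i_1, ..., i_r); the first index is kept
   apart because it is the one that the product A x does not sum over. *)
Definition adjacency_tensor (R : realType) (r : nat) (H : hypergraph)
    (i : H) (t : r.-1.-tuple H) : R[i] :=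
  if [set x in i :: t] \in edges H then ((r.-1)`!%:R)^-1 else 0.

Definition tensor_apply (R : realType) (r : nat) (V : finType)
    (A : V -> r.-1.-tuple V -> R[i]) (x : {ffun V -> R[i]}) (i : V) : R[i] :=
  \sum_(t : r.-1.-tuple V) A i t * \prod_(j <- t) x j.

Definition is_eigenvalue (R : realType) (r : nat) (H : hypergraph)
    (lam : R[i]) : Prop :=
  exists2 x : {ffun H -> R[i]}, x != 0 &
    forall i, tensor_apply (@adjacency_tensor R r H) x i = lam * x i ^+ r.-1.

Definition is_spectral_radius (R : realType) (r : nat) (H : hypergraph)
    (rho : R) : Prop :=
  (exists2 lam : R[i], is_eigenvalue r H lam & `|lam| = rho%:C) /\
  (forall lam : R[i], is_eigenvalue r H lam -> `|lam| <= rho%:C).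

(* The maximum modulus, selected as the unique rho satisfying
   is_spectral_radius; the default value 0 is for totality only. *)
Definition spectral_radius (R : realType) (r : nat) (H : hypergraph) : R :=
  xget 0 [set rho | is_spectral_radius r H rho]%classic.

(* The r-th power of an ordinary (2-uniform) graph G: the new vertices are
   the pairs (e, j) with e an edge of G and j < r - 2. *)
Section Power.
Variables (G : hypergraph) (r : nat).

Definition edge_type := {e : {set G} | e \in edges G}.

Definition power_vert : finType := (G + edge_type * 'I_(r - 2))%type.

Definition power_edge (e : edge_type) : {set power_vert} :=
  [set inl x | x in val e] :|: [set inr (e, j) | j : 'I_(r - 2)].

Definition power : hypergraph :=
  @Hypergraph power_vert [set power_edge e | e : edge_type].
End Power.

(* Vertices are numbered from 0, so the path vertex v_j (1 <= j <= d + 1) is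
   inl (inord j.-1); the inr k are the m - d pendent vertices. *)
Section Tree.
Variables (m d i : nat).

Definition Tvert : finType := ('I_d.+1 + 'I_(m - d))%type.

Definition pathv (j : nat) : Tvert := inl (inord j.-1).

Definition Ttree : hypergraph := @Hypergraph Tvert
  ([set [set pathv j.+1; pathv j.+2] | j : 'I_d] :|:
   [set [set pathv i; inr k] | k : 'I_(m - d)]).
End Tree.

Definition Tpow (r m d i : nat) : hypergraph := power (Ttree m d i) r.

(* Main.v *)
(* Give every incidence v \in e of an r-uniform hypergraph a label
   B(v, e) >= 0 whose sum at each vertex is at most 1 and whose product along
   each edge is at least al.  By AM-GM every eigenvalue satisfies
   |lam| ^ r <= 1 / al, and on a supertree equality everywhere yields a positive
   eigenvector (Lu and Man).  A supertree with d + 2 edges and diameter d is a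
   path of d edges with two further edges, and a path of k edges hanging at a
   vertex forces there the label arm k, where arm 0 = 0 and
   arm (k + 1) = al / (1 - arm k).  If both extra edges sit at a vertex of the
   path with arms k and l, equality means 2 al + arm k + arm l = 1; since arm is
   strictly concave in k, balancing the arms lowers the solution al, that is,
   raises the spectral radius.  All other supertrees can be labelled with one
   fixed al, for which 2 al + arm 2 + arm (d - 2) > 1. *)

Require Import Defs.
From mathcomp Require Import all_boot all_order all_algebra.
From mathcomp Require classical_sets.
From mathcomp Require Import reals complex ring lra zify.

Set Implicit Arguments.
Unset Strict Implicit.
Unset Printing Implicit Defensive.

Import Order.TTheory GRing.Theory Num.Theory.

Local Open Scope ring_scope.

(** * The adjacency tensor and the AM-GM bound *)

(** No Perron-Frobenius theory enters: a labelling bounds every eigenvalue from above, and a tight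
    one also produces an eigenvector, so the maximum modulus is located from both sides. Labels
    become manageable through an enumeration of the edges in which each edge meets the union of its
    predecessors in a single vertex. A labelling is then one free number per edge, its label at that
    vertex; every other label is what remains of the vertex sum 1. Abstract supertrees and the
    explicit powers [Tpow] both get such an enumeration, with a path of [d] edges first and the two
    extra edges last, so one calculation serves both. The competitors are neither classified up to
    isomorphism nor are their radii computed: it only matters whether the second extra edge hangs on
    a new vertex of the first, shares its attachment vertex, or sits elsewhere on the path edges.
    The fixed [al] has to leave room for all these competitors and yet exceed the solution of the
    threshold equation for T(3), which leaves only a narrow choice. *)

Lemma mem_set_cons (T : finType) (i : T) (t : seq T) (e : {set T}) :
  size t = #|e|.-1 -> i \in e ->
  ([set x in i :: t] == e) = all [in e :\ i] t && uniq t.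
Proof.
move=> st ie.
have ce : #|e| = (size (i :: t))%N by rewrite /= st prednK //; apply/card_gt0P; exists i.
apply/eqP/andP => [E|[/allP A U]].
  have U : uniq (i :: t).
    apply/card_uniqP; rewrite -ce -E.
    by apply: eq_card => x; rewrite inE.
  move: U => /= /andP[it U]; split=> //.
  apply/allP => x xt; rewrite !inE.
  have -> : x \in e by rewrite -E !inE xt orbT.
  by rewrite andbT; apply: contraNneq it => <-.
apply/eqP; rewrite eqEcard; apply/andP; split.
  apply/subsetP => x; rewrite !inE => /orP[/eqP->//|/A].
  by rewrite !inE => /andP[].
have UU : uniq (i :: t).
  rewrite /= U andbT; apply/negP => /A; by rewrite !inE eqxx.
rewrite ce -(card_uniqP UU); apply: subset_leq_card.
by apply/subsetP => x; rewrite inE.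
Qed.

(** The ordered enumerations of an edge without [i] number [(r-1)!], which cancels the normalisation
    of the tensor and leaves one monomial per edge at [i]. *)
Lemma tensor_applyE (R : realType) (r : nat) (H : hypergraph)
    (x : {ffun H -> R[i]}) (i : H) :
  uniform r H -> (0 < r)%N ->
  tensor_apply (@adjacency_tensor R r H) x i =
  \sum_(e in edges H | i \in e) \prod_(j in e :\ i) x j.
Proof.
move=> unif r0; rewrite /tensor_apply /adjacency_tensor.
rewrite (eq_bigr (fun t : r.-1.-tuple H =>
  \sum_(e in edges H | i \in e) (if [set x in i :: t] == e then
     ((r.-1)`!%:R)^-1 * \prod_(j <- t) x j else 0))); last first.
  move=> t _; case: ifPn => [tE|tE]; last first.
    rewrite mul0r [RHS]big1 // => e /andP[eE _]; case: eqP => // te.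
    by rewrite te eE in tE.
  rewrite (bigD1 [set x in i :: t]) /=; last by rewrite tE !inE eqxx.
  rewrite eqxx [X in _ + X]big1 ?addr0 // => e /andP[_ ne].
  by rewrite eq_sym (negPf ne).
rewrite exchange_big /=; apply: eq_bigr => e /andP[eE ie].
have ce := unif e eE.
have cei : #|e :\ i| = r.-1 by rewrite (cardsD1 i) ie /= in ce; rewrite -ce.
rewrite -big_mkcond /=.
rewrite (eq_bigr (fun=> (r.-1)`!%:R^-1 * \prod_(j in e :\ i) x j)); last first.
  move=> t; rewrite mem_set_cons ?size_tuple ?ce // => /andP[/allP A U].
  congr (_ * _); rewrite -big_enum /=; apply: perm_big.
  apply: uniq_perm; rewrite ?enum_uniq // => z.
  have sub : {subset t <= enum (e :\ i)} by move=> z' /A; rewrite mem_enum.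
  have [] := uniq_min_size U sub; first by rewrite -cardE cei size_tuple.
  by move=> _ ->.
rewrite sumr_const -[LHS]mulr_natl mulrA.
have -> : #|[pred t : r.-1.-tuple H | [set x in i :: t] == e]| = (r.-1)`!.
  have := card_uniq_tuples r.-1 [in e :\ i]; rewrite cei ffactnn => <-; apply: eq_card => t.
  by rewrite !inE mem_set_cons ?size_tuple ?ce.
by rewrite mulfV ?mul1r // pnatr_eq0 -lt0n fact_gt0.
Qed.

Lemma nth_root_exists (R : rcfType) (n : nat) (y : R) :
  (0 < n)%N -> 0 < y -> exists2 x, 0 < x & x ^+ n = y.
Proof.
move=> n0 y0; have [||x /andP[x0 _]] := @poly_ivt _ ('X^n - y%:P) 0 (1 + y).
- by rewrite addr_ge0 // ltW.
- rewrite !hornerE expr0n (negPf (lt0n_neq0 n0)) sub0r oppr_le0 ltW //=.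
  rewrite subr_ge0; apply: (@le_trans _ _ (1 + y)); first by lra.
  by rewrite -{1}(expr1 (1 + y)) ler_weXn2l //; lra.
rewrite rootE !hornerE subr_eq0 => /eqP E.
exists x => //; rewrite lt_neqAle x0 andbT; apply/eqP => x00.
by move: y0; rewrite -E -x00 expr0n (negPf (lt0n_neq0 n0)) ltxx.
Qed.

Section Bound.
Variables (R : realType) (r : nat) (H : hypergraph) (m : nat).
Variables (E : nat -> {set H}) (B : H -> nat -> R) (a : R).
Hypothesis r0 : (0 < r)%N.
Hypothesis Hr : uniform r H.
Hypothesis edgesE : edges H = [set E k | k : 'I_m].
Hypothesis Einj : forall k l, (k < m)%N -> (l < m)%N -> E k = E l -> k = l.
Hypothesis a0 : 0 < a.

Lemma big_edges (S : nmodType) (F : {set H} -> S) :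
  \sum_(e in edges H) F e = \sum_(k < m) F (E k).
Proof.
rewrite edgesE big_imset //= => k l _ _ Ekl; apply/val_inj.
by apply: Einj Ekl.
Qed.

Lemma big_edges_mem (S : nmodType) (F : {set H} -> S) v :
  \sum_(e in edges H | v \in e) F e = \sum_(k < m | v \in E k) F (E k).
Proof.
rewrite big_mkcondr [RHS]big_mkcond /=; exact: big_edges.
Qed.

Hypothesis B0 : forall v k, (k < m)%N -> v \in E k -> 0 <= B v k.
Hypothesis Bsum : forall v, \sum_(k < m | v \in E k) B v k <= 1.
Hypothesis Bprod : forall k, (k < m)%N -> a ^+ r <= \prod_(v in E k) B v k.

(** Passing to moduli, multiplying the equation at [v] by [y v] and summing over [v] counts each
    edge monomial [r] times. AM-GM for the numbers [B u k * y u ^+ r] bounds [r * a] times the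
    monomial by their sum over the edge, and the vertex sums bring the total down to [Y], which
    cancels. *)
Lemma eigenvalue_le (lam : R[i]) :
  is_eigenvalue r H lam -> a * ComplexField.Normc.normc lam <= 1.
Proof.
case=> x x_neq0 eigen.
pose y v : R := ComplexField.Normc.normc (x v).
pose mu := ComplexField.Normc.normc lam.
have yC v : (y v)%:C%C = `|x v| by [].
have y0 v : 0 <= y v by rewrite -lecR yC normr_ge0.
have eqv v : mu * y v ^+ r <= \sum_(k < m | v \in E k) \prod_(u in E k) y u.
  have := eigen v; rewrite tensor_applyE // big_edges_mem => ev.
  have : mu * y v ^+ r.-1 <= \sum_(k < m | v \in E k) \prod_(u in E k :\ v) y u.
    rewrite -lecR rmorphM rmorphXn /= yC.
    have -> : mu%:C%C = `|lam| by [].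
    rewrite -normrX -normrM -ev; apply: le_trans (ler_norm_sum _ _ _) _.
    rewrite rmorph_sum /=; apply: ler_sum => k _.
    by rewrite normr_prod rmorph_prod /=; apply: ler_prod => u _; rewrite yC normr_ge0 lexx.
  move=> /(ler_wpM2l (y0 v)); rewrite mulrCA -exprS prednK // => /le_trans; apply.
  rewrite mulr_sumr; apply: ler_sum => k vk.
  by rewrite [leRHS](big_setD1 v).
have AG k : (k < m)%N ->
    r%:R * a * \prod_(u in E k) y u <= \sum_(u in E k) B u k * y u ^+ r.
  move=> km; have ck : #|E k| = r.
    by apply: Hr; rewrite edgesE; apply/imsetP; exists (Ordinal km).
  have h u : u \in E k -> 0 <= B u k * y u ^+ r.
    by move=> uk; rewrite mulr_ge0 ?B0 ?exprn_ge0.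
  have [+ _] := @leif_AGM _ _ (mem (E k)) (fun u => B u k * y u ^+ r) h.
  rewrite ck big_split /= prodrXl => AG.
  have : (a * \prod_(u in E k) y u) ^+ r <= ((\sum_(u in E k) B u k * y u ^+ r) / r%:R) ^+ r.
    apply: le_trans AG; rewrite exprMn ler_wpM2r ?exprn_ge0 ?prodr_ge0 //.
    exact: Bprod.
  rewrite ler_pXn2r ?nnegrE //; last 2 first.
  - by rewrite mulr_ge0 ?prodr_ge0 // ltW.
  - by rewrite divr_ge0 // sumr_ge0.
  by rewrite ler_pdivlMr ?ltr0n // mulrC mulrA.
set Y := \sum_v y v ^+ r.
have Y0 : 0 < Y.
  rewrite lt_neqAle sumr_ge0 ?andbT; last by move=> v _; rewrite exprn_ge0.
  apply: contraNneq x_neq0 => Y0; apply/eqP/ffunP => v; rewrite ffunE.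
  have h u : true -> 0 <= y u ^+ r by rewrite exprn_ge0.
  have /eqP := psumr_eq0P h (esym Y0) (isT : xpredT v).
  by rewrite expf_eq0 r0 /= => /eqP yv; apply/eqP; rewrite -normr_eq0 -yC yv.
suff : a * mu * Y <= 1 * Y by rewrite ler_pM2r.
rewrite mul1r.
have le1 : mu * Y <= r%:R * \sum_(k < m) \prod_(u in E k) y u.
  rewrite mulr_sumr; apply: (@le_trans _ _ (\sum_v \sum_(k < m | v \in E k) \prod_(u in E k) y u)).
    by apply: ler_sum.
  rewrite (exchange_big_dep xpredT) //= mulr_sumr; apply: ler_sum => k _.
  rewrite sumr_const mulr_natl.
  by have -> : #|[pred i | i \in E k]| = r; [apply: Hr; rewrite edgesE; apply/imsetP; exists k|].
rewrite -mulrA; apply: le_trans (ler_wpM2l (ltW a0) le1) _.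
rewrite mulrCA mulrA mulr_sumr.
apply: (@le_trans _ _ (\sum_(k < m) \sum_(u in E k) B u k * y u ^+ r)).
  by apply: ler_sum => k _; exact: AG.
rewrite (exchange_big_dep xpredT) //=; apply: ler_sum => v _.
by rewrite -mulr_suml ler_piMl ?exprn_ge0.
Qed.

End Bound.

(** * Growing a supertree edge by edge *)

Fixpoint grown (V : finType) (root : V) (E : nat -> {set V}) (k : nat) : {set V} :=
  if k is k'.+1 then grown root E k' :|: E k' else [set root].

Lemma grown_mono (V : finType) (root : V) E k l :
  (k <= l)%N -> grown root E k \subset grown root E l.
Proof.
elim: l => [|l IH]; first by rewrite leqn0 => /eqP ->.
rewrite leq_eqVlt => /orP[/eqP->//|/IH/subset_trans]; apply.
exact: subsetUl.
Qed.

Lemma sub_grown (V : finType) (root : V) (E : nat -> {set V}) k l :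
  (k < l)%N -> E k \subset grown root E l.
Proof.
by move=> kl; apply: subset_trans (grown_mono root E kl); exact: subsetUr.
Qed.

(** An edge order in which every edge meets the union of its predecessors in exactly the vertex
    [p k]. Before edge 0 this union is the single vertex [p 0], which serves as the root. *)
Record growth (H : hypergraph) (m : nat) (E : nat -> {set H}) (p : nat -> H) : Prop := {
  growth_edges : edges H = [set E k | k : 'I_m];
  growth_attach : forall k, (k < m)%N -> E k :&: grown (p 0%N) E k = [set p k];
  growth_cover : grown (p 0%N) E m = [set: H] }.

Section Growth.
Variables (H : hypergraph) (m : nat) (E : nat -> {set H}) (p : nat -> H).
Hypothesis G : growth m E p.
Local Notation root := (p 0%N).
Local Notation U := (grown root E).

Lemma growth_memE k : (k < m)%N -> E k \in edges H.
Proof. by move=> km; rewrite (growth_edges G); apply/imsetP; exists (Ordinal km). Qed.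

Lemma growth_memP e : e \in edges H -> exists2 k, (k < m)%N & e = E k.
Proof. by rewrite (growth_edges G) => /imsetP[k _ ->]; exists k. Qed.

Lemma growth_attachE k v : (k < m)%N -> v \in E k -> v \in U k -> v = p k.
Proof.
move=> km vE vU; apply/set1P; rewrite -(growth_attach G km) inE vE vU //.
Qed.

Lemma attach_mem k : (k < m)%N -> (p k \in E k) * (p k \in U k).
Proof.
move=> km; have : p k \in E k :&: U k by rewrite (growth_attach G km) set11.
by rewrite inE => /andP[-> ->].
Qed.

Lemma root_grown k : root \in U k.
Proof. by apply: (subsetP (grown_mono root E (leq0n k))); rewrite set11. Qed.

(** A vertex is new only once. Together with [parent_exists]: every vertex except the root has
    exactly one edge in which it is not the attachment vertex, and all its other edges are attached
    at it. *)
Lemma parent_uniq k l v : (k < m)%N -> (l < m)%N ->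
  v \in E k -> v != p k -> v \in E l -> v != p l -> k = l.
Proof.
wlog kl : k l / (k <= l)%N => [W|] km lm vk nk vl nl.
  by case: (leqP k l) => [kl|/ltnW kl]; [|symmetry]; apply: W.
move: kl; rewrite leq_eqVlt => /orP[/eqP//|kl].
have vU : v \in U l by apply: (subsetP (sub_grown root E kl)).
by rewrite (growth_attachE lm vl vU) eqxx in nl.
Qed.

Lemma parent_exists v : v != root ->
  exists k, [/\ (k < m)%N, v \in E k, v != p k & v \notin U k].
Proof.
move=> vr; suff ex n : (n <= m)%N -> v \in U n ->
    exists k, [/\ (k < m)%N, v \in E k, v != p k & v \notin U k].
  by apply: (ex m) => //; rewrite (growth_cover G) inE.
elim: n => [|k IH] km; first by rewrite inE (negPf vr).
rewrite inE; case: (boolP (v \in U k)) => [/(IH (ltnW km))//|vU /= vE].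
exists k; split=> //; apply: contraNneq vU => ->; by case: (attach_mem km).
Qed.

Lemma root_attach k : (k < m)%N -> root \in E k -> root = p k.
Proof. by move=> km rE; apply: growth_attachE => //; exact: root_grown. Qed.

Section Uniform.
Variable r : nat.
Hypothesis r2 : (2 <= r)%N.
Hypothesis Hr : uniform r H.

Lemma growth_inj k l : (k < m)%N -> (l < m)%N -> E k = E l -> k = l.
Proof.
wlog kl : k l / (k <= l)%N => [W|] km lm Ekl.
  by case: (leqP k l) => [kl|/ltnW kl]; [|symmetry]; apply: W.
move: kl; rewrite leq_eqVlt => /orP[/eqP//|kl].
have := growth_attach G lm; rewrite -Ekl (setIidPl (sub_grown root E kl)) => Ek.
by move: r2; rewrite -(Hr (growth_memE km)) Ek cards1.
Qed.

Lemma growth_card : #|edges H| = m.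
Proof.
rewrite (growth_edges G) card_imset ?card_ord // => k l Ekl.
by apply/val_inj; apply: growth_inj Ekl.
Qed.

Variables (R : realType) (b : nat -> R) (a : R).
Hypothesis a0 : 0 < a.
(** Only the label [b k] of [E k] at [p k] is free; at its other vertices the edge receives
    [1 - load v]. The label sum is then automatically 1 at every vertex except the root, where it is
    [load] itself. *)
Definition load v : R := \sum_(k < m | p k == v) b k.
Let B v k := if v == p k then b k else 1 - load v.

Lemma attached_eq k v : (k < m)%N -> p k == v -> v \in E k.
Proof. by move=> km /eqP<-; case: (attach_mem km). Qed.

Lemma sum_parent v (F : nat -> R) k : (k < m)%N -> v \in E k -> v != p k ->
  \sum_(l < m | v \in E l) F l = \sum_(l < m | p l == v) F l + F k.
Proof.
move=> km vE nv; rewrite (bigID (fun l : 'I_m => p l == v)) /=; congr (_ + _).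
  by apply: eq_bigl => l; case: eqP => [/eqP/attached_eq->//|]; rewrite ?andbF.
rewrite (big_pred1 (Ordinal km)) // => l /=; apply/andP/eqP => [[vl nl]|->/=].
  by apply/val_inj; rewrite eq_sym in nl; exact: (parent_uniq (ltn_ord l) km vl nl vE nv).
by rewrite vE eq_sym.
Qed.

Lemma sum_noparent v (F : nat -> R) :
  (forall k, (k < m)%N -> v \in E k -> v = p k) ->
  \sum_(l < m | v \in E l) F l = \sum_(l < m | p l == v) F l.
Proof.
move=> h; apply: eq_bigl => l; apply/idP/idP => [/h->//|]; exact: attached_eq.
Qed.

Lemma prod_label k : (k < m)%N ->
  \prod_(v in E k) B v k = b k * \prod_(v in E k :\ p k) (1 - load v).
Proof.
move=> km; rewrite (big_setD1 (p k)) /=; last by case: (attach_mem km).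
rewrite {1}/B eqxx; congr (_ * _); apply: eq_bigr => v.
by rewrite !inE /B => /andP[/negPf-> _].
Qed.

Lemma label_bound (lam : R[i]) :
  (forall k, (k < m)%N -> 0 <= b k) ->
  (forall v, load v <= 1) ->
  (forall k, (k < m)%N -> a ^+ r <= b k * \prod_(v in E k :\ p k) (1 - load v)) ->
  is_eigenvalue r H lam -> a * ComplexField.Normc.normc lam <= 1.
Proof.
move=> b0 l1 pr; apply: (@eigenvalue_le _ _ _ m E B) => //.
- exact: ltnW.
- exact: (growth_edges G).
- exact: growth_inj.
- by move=> v k km _; rewrite /B; case: ifP => _; rewrite ?b0 ?subr_ge0.
- move=> v.
  have eqB : \sum_(k < m | p k == v) B v k = load v.
    by apply: eq_bigr => k /eqP <-; rewrite /B eqxx.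
  have [vr|/parent_exists[k [km vE nv _]]] := eqVneq v root.
    by rewrite sum_noparent; [rewrite eqB vr|move=> k; rewrite vr; exact: root_attach].
  by rewrite (sum_parent _ km vE nv) eqB /B (negPf nv) addrC subrK.
- by move=> k km; rewrite prod_label // pr.
Qed.

Hypothesis l_root : load root = 1.
Hypothesis l_lt1 : forall v, v != root -> load v < 1.
Hypothesis b_gt0 : forall k, (k < m)%N -> 0 < b k.
Hypothesis b_prod : forall k, (k < m)%N ->
  a ^+ r = b k * \prod_(v in E k :\ p k) (1 - load v).

(* [y] is the r-th power of the eigenvector: at a vertex v <> p k of E k the
   ratio y v / y (p k) of a consistent labelling is B (p k) k / B v k. *)
Lemma power_vector : exists2 y : H -> R, (forall v, 0 < y v) &
  forall k, (k < m)%N -> forall v, v \in E k -> v != p k ->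
    y v = y (p k) * b k / (1 - load v).
Proof.
suff ex n : exists2 y : H -> R, (forall v, 0 < y v) &
  forall k, (k < n)%N -> (k < m)%N -> forall v, v \in E k -> v != p k ->
    y v = y (p k) * b k / (1 - load v).
  by case: (ex m) => y y0 h; exists y => // k km; exact: h.
elim: n => [|n [y y0 IH]]; first by exists (fun=> 1).
case: (ltnP n m) => nm; last first.
  by exists y => // k _ km; apply: IH => //; exact: leq_trans km nm.
exists (fun v => if (v \in E n) && (v != p n) then y (p n) * b n / (1 - load v) else y v).
    move=> v; case: ifP => // /andP[vE nv].
    rewrite !mulr_gt0 ?b_gt0 ?invr_gt0 ?subr_gt0 ?l_lt1 //.
    by apply: contraNneq nv => vr; rewrite {1}vr (root_attach nm) // -vr.
  move=> k; rewrite ltnS leq_eqVlt => /orP[/eqP->|kn] km v vE nv.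
    by rewrite vE nv eqxx andbF.
  have sub u : u \in E k -> (u \in E n) && (u != p n) = false.
    move=> uE; apply/negP => /andP[un /eqP]; apply.
    by apply: growth_attachE => //; apply: (subsetP (sub_grown root E kn)).
  rewrite !sub //; last by case: (attach_mem km).
  exact: IH.
Qed.

Lemma label_eigen : is_eigenvalue r H (a^-1)%:C%C.
Proof.
have r0 : (0 < r)%N by exact: ltnW.
have [y y0 yE] := power_vector.
have [x xP] : exists x : H -> R, forall v, 0 < x v /\ x v ^+ r = y v.
  apply: (fin_all_exists (P := fun v z => 0 < z /\ z ^+ r = y v)) => v.
  by have [z] := nth_root_exists r0 (y0 v); exists z.
have x0 v : 0 < x v by case: (xP v).
have xr v : x v ^+ r = y v by case: (xP v).
(* Compared through r-th powers: the [r - 1] vertices other than [p k] contribute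
   [(y (p k) * b k) ^+ r.-1] divided by a product of factors [1 - load v], and [b_prod] says that
   this product is [a ^+ r / b k]. *)
have X k : (k < m)%N -> \prod_(u in E k) x u = a^-1 * b k * y (p k).
  move=> km; apply: (@pexpIrn _ r) => //.
  - by rewrite nnegrE prodr_ge0 // => u _; exact: ltW.
  - by rewrite nnegrE !mulr_ge0 ?invr_ge0 // ltW // b_gt0.
  rewrite -prodrXl (eq_bigr y) => [|u _]; last exact: xr.
  rewrite (big_setD1 (p k)) /=; last by case: (attach_mem km).
  rewrite (eq_bigr (fun v => y (p k) * b k / (1 - load v))); last first.
    by move=> v; rewrite !inE => /andP[nv vE]; exact: yE.
  rewrite big_split /= prodr_const.
  have -> : #|E k :\ p k| = r.-1.
    by rewrite -(Hr (growth_memE km)) (cardsD1 (p k) (E k)) (attach_mem km).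
  rewrite -[r in RHS]prednK // !exprMn exprVn [a ^+ _.+1]exprS -exprS prednK // (b_prod km).
  have := b_gt0 km; have pr0 : 0 < \prod_(v in E k :\ p k) (1 - load v).
    have := exprn_gt0 r a0; rewrite (b_prod km) pmulr_rgt0 //; exact: b_gt0.
  rewrite prodfV.
  move=> bk; rewrite -[in RHS](prednK r0) !exprS; field.
  by rewrite !lt0r_neq0.
(* After multiplication by [x v], each edge term is [a^-1] times the label at [v] times [y v], and
   the labels at [v] sum to 1, at the root by [l_root]. *)
have xE v : \sum_(k < m | v \in E k) \prod_(u in E k :\ v) x u = a^-1 * x v ^+ r.-1.
  apply: (mulfI (lt0r_neq0 (x0 v))); rewrite mulrCA -exprS prednK // xr mulr_sumr.
  rewrite (eq_bigr (fun k : 'I_m => a^-1 * b k * y (p k))); last first.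
    by move=> k vE; rewrite -X // [RHS](big_setD1 v).
  have att : \sum_(k < m | p k == v) a^-1 * b k * y (p k) = a^-1 * load v * y v.
    by rewrite mulr_sumr mulr_suml; apply: eq_bigr => k /eqP->.
  have [vr|vr] := eqVneq v root.
    rewrite (sum_noparent (fun k => a^-1 * b k * y (p k))); last first.
      by move=> k; rewrite vr; exact: root_attach.
    by rewrite att vr l_root mulr1.
  have [k [km vE nv _]] := parent_exists vr.
  rewrite (sum_parent (fun k => a^-1 * b k * y (p k)) km vE nv) att (yE k km v vE nv).
  by field; rewrite !lt0r_neq0 ?subr_gt0 ?l_lt1.
exists [ffun v => (x v)%:C%C].
  apply/eqP => /ffunP/(_ root); rewrite !ffunE => /eqP.
  by rewrite (fmorph_eq0 (real_complex R)) gt_eqF.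
move=> v; rewrite tensor_applyE // (big_edges_mem (growth_edges G) growth_inj).
rewrite ffunE -rmorphXn -rmorphM -xE rmorph_sum /=; apply: eq_bigr => k _.
by rewrite rmorph_prod /=; apply: eq_bigr => u _; rewrite ffunE.
Qed.

(** The labels that produce the eigenvector also satisfy the hypotheses of [label_bound], with
    equality in the products, so the eigenvalue found has the largest modulus. *)
Lemma label_spectral_radius : is_spectral_radius r H a^-1.
Proof.
split.
  exists (a^-1)%:C%C; first exact: label_eigen.
  by rewrite normc_def /= expr0n addr0 sqrtr_sqr ger0_norm // invr_ge0 ltW.
move=> lam /label_bound h.
have -> : `|lam| = (ComplexField.Normc.normc lam)%:C%C by [].
rewrite lecR -[a^-1]mulr1 ler_pdivlMl //; apply: h.
- by move=> k /b_gt0/ltW.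
- move=> v; have [->|/l_lt1/ltW//] := eqVneq v root; by rewrite l_root.
- by move=> k /b_prod ->.
Qed.

End Uniform.
End Growth.

Local Close Scope ring_scope.

(** * Walks and supertrees *)

(** Walks with a length bound compose and reverse without regard to repetitions; [reach_path]
    converts back to a path within the same bound. *)
Definition reach (H : hypergraph) (n : nat) (x y : H) : Prop :=
  exists s, [/\ walk x s, walk_end x s = y & size s <= n].

Section Reach.
Variable H : hypergraph.
Implicit Types (x y z : H) (s : seq ({set H} * H)) (e : {set H}).

Lemma walk_cat x s t : walk x (s ++ t) = walk x s && walk (walk_end x s) t.
Proof. by elim: s x => //= -[e y] s IH x; rewrite IH -!andbA. Qed.

Lemma walk_end_cat x s t : walk_end x (s ++ t) = walk_end (walk_end x s) t.
Proof. by rewrite /walk_end /unzip2 map_cat last_cat. Qed.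

Lemma reach_refl n x : reach n x x.
Proof. by exists [::]. Qed.

Lemma reach_edge e x y : e \in edges H -> x \in e -> y \in e -> reach 1 x y.
Proof. by move=> eH xe ye; exists [:: (e, y)]; split=> //=; rewrite eH xe ye. Qed.

Lemma reach_trans k l x y z : reach k x y -> reach l y z -> reach (k + l) x z.
Proof.
move=> [s [ws es ss]] [t [wt et st]]; exists (s ++ t); split.
- by rewrite walk_cat ws es.
- by rewrite walk_end_cat es.
- by rewrite size_cat leq_add.
Qed.

Lemma reach_leq k l x y : k <= l -> reach k x y -> reach l x y.
Proof. by move=> kl [s [ws es ss]]; exists s; split=> //; apply: leq_trans kl. Qed.

Lemma reach_sym n x y : reach n x y -> reach n y x.
Proof.
case=> s [+ + +]; elim: s n x => [|[e z] s IH] n x /=; first by move=> _ <- _; exact: reach_refl.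
move=> /and4P[eH xe ze ws] es; case: n => // n; rewrite ltnS => sn.
rewrite -addn1; apply: reach_trans (IH _ _ ws es sn) _; exact: reach_edge ze xe.
Qed.

Lemma walk_edge_mem e x s : walk x s -> e \in unzip1 s -> has [in e] (unzip2 s).
Proof.
elim: s x => //= -[e1 y] s IH x /= /and4P[_ _ ye ws].
by rewrite inE => /orP[/eqP->|/(IH _ ws)->]; rewrite ?ye ?orbT.
Qed.

(** The edge [e] leads to the last vertex of the old path that lies in [e], so neither [x] nor [e]
    can recur afterwards. If that vertex is [x] itself, the edge is dropped. *)
Lemma path_extend e x y s : e \in edges H -> x \in e -> is_path y s ->
  has [in e] (y :: unzip2 s) ->
  exists s', [/\ is_path x s', walk_end x s' = walk_end y s & size s' <= (size s).+1].
Proof.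
move=> eH xe; elim: s y => [|[e1 y1] s IH] y ps; have ps0 := ps; rewrite /=.
  rewrite orbF => ye; have [->|xy] := eqVneq x y; first by exists [::].
  by exists [:: (e, y)]; split=> //; rewrite /is_path /= eH xe ye inE xy.
have [hs _|/norP[/negPf y1e /hasPn hs]] := boolP (has [in e] (y1 :: unzip2 s)).
  have ps' : is_path y1 s by move: ps; rewrite /is_path /= => /and3P[/and4P[_ _ _ ->] /andP[_ ->] /andP[_ ->]].
  have [s' [p1 p2 p3]] := IH _ ps' hs; exists s'; split=> //; exact: leq_trans p3 _.
rewrite y1e (negPf (introN hasP _)) ?orbF => [ye|[z zs ze]]; last by have := hs z zs; rewrite ze.
have [->|xy] := eqVneq x y; first by exists ((e1, y1) :: s).
exists [:: (e, y), (e1, y1) & s]; split=> //.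
move: ps; rewrite /is_path /= eH xe ye /= => /and3P[-> -> ->]; rewrite !andbT /=.
have nin z : z \in y1 :: unzip2 s -> z \notin e.
  by rewrite inE => /orP[/eqP->|/hs //]; rewrite y1e.
rewrite inE (negPf xy) /=; apply/andP; split.
  by apply/negP => /nin; rewrite xe.
apply/negP => ei; have /hasP[z zs] : has [in e] (y1 :: unzip2 s).
  have wk : walk y ((e1, y1) :: s) by move: ps0; rewrite /is_path => /andP[].
  exact: (walk_edge_mem wk ei).
by move=> ze; have := nin z zs; rewrite ze.
Qed.

Lemma reach_path n x y : reach n x y ->
  exists s, [/\ is_path x s, walk_end x s = y & size s <= n].
Proof.
case=> s [+ + +]; elim: s n x => [|[e z] s IH] n x /=; first by move=> _ <- _; exists [::].
move=> /and4P[eH xe ze ws] es; case: n => // n; rewrite ltnS => sn.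
have [t [pt et st]] := IH n z ws es sn.
have hz : has [in e] (z :: unzip2 t) by rewrite /= ze.
have [t' [p1 p2 p3]] := path_extend eH xe pt hz.
by exists t'; split=> //; [rewrite p2|exact: leq_trans p3 _].
Qed.

Lemma walk_sub (S : {set {set H}}) x s : S \subset edges H ->
  @walk (@Hypergraph H S) x s -> walk x s.
Proof.
move=> /subsetP SH; elim: s x => //= -[e y] s IH x /and4P[/SH -> -> ->] /=; exact: IH.
Qed.

Lemma reach_sub (S : {set {set H}}) n x y : S \subset edges H ->
  @reach (@Hypergraph H S) n x y -> reach n x y.
Proof. by move=> SH [s [ws es ss]]; exists s; split=> //; exact: walk_sub ws. Qed.

Lemma walk_edges x s : walk x s -> {subset unzip1 s <= edges H}.
Proof.
elim: s x => //= -[e y] s IH x /and4P[eH _ _ /IH h] f.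
by rewrite inE => /orP[/eqP->|/h].
Qed.

End Reach.

(** A path from [a] to [b] through edges of [S], closed by [e], is a cycle unless the two vertices
    coincide; [e \notin S] keeps the edges distinct. *)
Lemma acyclic_attach (H : hypergraph) (S : {set {set H}}) n (a b : H) e :
  (forall (x : H) s, ~~ is_cycle x s) -> S \subset edges H ->
  @reach (@Hypergraph H S) n a b -> e \in edges H -> e \notin S ->
  a \in e -> b \in e -> a = b.
Proof.
move=> acyc SH /reach_path[s [ps es _]] eH eS ae be; apply/eqP/negPn/negP => ab.
have := acyc a (s ++ [:: (e, a)]); rewrite /is_cycle => /negP; apply.
move: ps; rewrite /is_path => /and3P[ws us1 us2].
have es' : walk_end (H := H) a s = b by [].
rewrite walk_cat es' (walk_sub SH ws) /= eH be ae /= walk_end_cat /walk_end /= eqxx /=.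
rewrite size_cat /unzip1 /unzip2 !map_cat /= !cats1 !rcons_uniq; apply/and3P; split.
- by rewrite addn1 ltnS lt0n size_eq0; apply: contraNneq ab => s0; rewrite -es' s0.
- exact: us1.
- rewrite us2 andbT; apply: contra eS => /(walk_edges ws) //.
Qed.

Lemma grown_ext (V : finType) (root : V) (E E' : nat -> {set V}) k :
  (forall l, l < k -> E l = E' l) -> grown root E k = grown root E' k.
Proof.
elim: k => //= k IH h; rewrite IH ?h // => l lk; apply: h; exact: ltnW.
Qed.

Lemma grownP (V : finType) (root : V) (E : nat -> {set V}) k u :
  reflect (u = root \/ exists2 l, l < k & u \in E l) (u \in grown root E k).
Proof.
elim: k => [|k IH] /=.
  rewrite inE; apply: (iffP eqP) => [->|[->//|[]//]]; by left.
rewrite inE; apply: (iffP orP) => [[/IH[->|[l lk ul]]|ul]|[ur|[l]]].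
- by left.
- by right; exists l => //; apply: ltnW.
- by right; exists k.
- by left; apply/IH; left.
- rewrite ltnS leq_eqVlt => /orP[/eqP->|lk] ul; first by right.
  by left; apply/IH; right; exists l.
Qed.

(** The part of [growth] that makes sense for a partial enumeration and extends one edge at a time:
    the intersection need only contain [p k]. In a supertree the absence of cycles shrinks it to a
    singleton. *)
Record pregrowth (H : hypergraph) (n : nat) (E : nat -> {set H}) (p : nat -> H) : Prop := {
  pregrowth_edges : forall k, k < n -> E k \in edges H;
  pregrowth_attach : forall k, k < n -> p k \in E k :&: grown (p 0) E k;
  pregrowth_inj : forall k l, k < n -> l < n -> E k = E l -> k = l }.

Lemma grown_reach (H : hypergraph) (S : {set {set H}}) n (E : nat -> {set H}) (p : nat -> H) k v :
  pregrowth n E p -> k <= n -> (forall l, l < k -> E l \in S) ->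
  v \in grown (p 0) E k -> @reach (@Hypergraph H S) k (p 0) v.
Proof.
move=> [_ att _]; elim: k v => [|k IH] v kn ES /=.
  by rewrite inE => /eqP->; exact: reach_refl.
rewrite inE => /orP[vU|vE].
  apply: reach_leq (leqnSn k) _; apply: IH => //; first exact: ltnW.
  by move=> l lk; apply: ES; exact: ltnW.
have /setIP[pE pU] := att k kn.
rewrite -addn1; apply: reach_trans (IH (p k) (ltnW kn) _ pU) _.
  by move=> l lk; apply: ES; exact: ltnW.
by apply: (@reach_edge (@Hypergraph H S) (E k)) => //; exact: ES.
Qed.

Lemma pregrowth_attachE (H : hypergraph) n (E : nat -> {set H}) (p : nat -> H) k :
  (forall (x : H) s, ~~ is_cycle x s) -> pregrowth n E p -> k < n ->
  E k :&: grown (p 0) E k = [set p k].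
Proof.
move=> acyc P kn; have [eE att inj] := P.
have /setIP[pE pU] := att k kn.
apply/setP => u; apply/setIP/set1P => [[uE uU]|->//].
pose S := [set E l | l : 'I_k].
have SE l : l < k -> E l \in S by move=> lk; apply/imsetP; exists (Ordinal lk).
have ru := grown_reach P (ltnW kn) SE uU; have rp := grown_reach P (ltnW kn) SE pU.
have SH : S \subset edges H.
  by apply/subsetP => _ /imsetP[l _ ->]; apply: eE; apply: ltn_trans kn.
apply: (acyclic_attach acyc SH (reach_trans (reach_sym ru) rp) (eE k kn)) => //.
apply/negP => /imsetP[l _ /inj]; move=> /(_ kn (ltn_trans (ltn_ord l) kn)) kl.
by have := ltn_ord l; rewrite -kl ltnn.
Qed.

Lemma walk_closed (H : hypergraph) (A : {set H}) x s :
  (forall e y, e \in edges H -> y \in e -> y \in A -> e \subset A) ->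
  walk x s -> x \in A -> walk_end x s \in A.
Proof.
move=> cl; elim: s x => //= -[e y] s IH x /and4P[eH xe ye ws] xA.
exact: (IH y ws (subsetP (cl e x eH xe xA) y ye)).
Qed.

Lemma connected_closed (H : hypergraph) (A : {set H}) x :
  connected_hg H -> x \in A ->
  (forall e y, e \in edges H -> y \in e -> y \in A -> e \subset A) -> A = [set: H].
Proof.
move=> con xA cl; apply/setP => y; rewrite inE.
have [s ps <-] := con x y; apply: (walk_closed cl) => //.
by move: ps; rewrite /is_path => /andP[].
Qed.

Lemma pregrowth_step (H : hypergraph) n (E : nat -> {set H}) (p : nat -> H) :
  connected_hg H -> (forall e, e \in edges H -> e != set0) ->
  pregrowth n E p -> n < #|edges H| ->
  exists e w, [/\ e \in edges H, forall l, l < n -> e <> E l, w \in e & w \in grown (p 0) E n].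
Proof.
move=> con ne P nm.
pose S := [set E l | l : 'I_n].
have : (0 < #|edges H :\: S|)%N.
  have cS : #|S| <= n by apply: leq_trans (leq_imset_card _ _) _; rewrite card_ord.
  rewrite cardsD subn_gt0; apply: leq_ltn_trans nm; apply: leq_trans cS.
  exact: subset_leq_card (subsetIr _ _).
case/card_gt0P => e; rewrite inE => /andP[eS eH].
have notS e' : e' \notin S -> forall l, l < n -> e' <> E l.
  by move=> e'S l ln el; case/negP: e'S; apply/imsetP; exists (Ordinal ln).
have [/existsP[e' /and3P[e'H e'S /set0Pn[w /setIP[we wU]]]]|/existsPn none] :=
  boolP [exists e' : {set H}, [&& e' \in edges H, e' \notin S & e' :&: grown (p 0) E n != set0]].
  by exists e', w; split=> //; exact: notS.
have full : grown (p 0) E n = [set: H].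
  apply: (connected_closed (x := p 0)) => //; first by apply/grownP; left.
  move=> e' y e'H ye yA; have := none e'; rewrite e'H /= negb_and negbK.
  case/orP => [/imsetP[l _ ->]|]; first exact: sub_grown.
  by rewrite negbK => /eqP/setP/(_ y); rewrite !inE ye yA.
have /set0Pn[w we] := ne e eH.
by exists e, w; split=> //; [exact: notS|rewrite full inE].
Qed.

(** The given initial segment is kept, so that a chosen path can come first; [0 < n] preserves its
    root. *)
Lemma pregrowth_extend (H : hypergraph) n (E : nat -> {set H}) (p : nat -> H) m :
  connected_hg H -> (forall e, e \in edges H -> e != set0) ->
  0 < n -> n <= m -> m <= #|edges H| -> pregrowth n E p ->
  exists E' p', [/\ pregrowth m E' p', forall k, k < n -> E' k = E k
                  & forall k, k < n -> p' k = p k].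
Proof.
move=> con ne n0; elim: m => [|m IH]; first by case: n n0.
rewrite leq_eqVlt => /orP[/eqP<-|nm] mH P; first by exists E, p.
have [E' [p' [P' EE pp]]] := IH nm (ltnW mH) P.
have [e [w [eH eN we wU]]] := pregrowth_step con ne P' mH.
exists (fun k => if k < m then E' k else e), (fun k => if k < m then p' k else w).
have m0 : 0 < m by exact: leq_trans n0 nm.
split; last 2 first.
- by move=> k kn; rewrite (leq_trans kn nm) EE.
- by move=> k kn; rewrite (leq_trans kn nm) pp.
have gE k : k <= m -> grown (p' 0) (fun k => if k < m then E' k else e) k = grown (p' 0) E' k.
  by move=> km; apply: grown_ext => l lk; rewrite (leq_trans lk km).
split.
- by move=> k _; case: ifP => // km; exact: (pregrowth_edges P').
- move=> k; rewrite m0 ltnS => km; rewrite gE //; case: ltnP => [km'|mk].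
    exact: (pregrowth_attach P').
  have -> : k = m by apply/eqP; rewrite eqn_leq km.
  by rewrite inE we.
- move=> k l; rewrite !ltnS; case: ltnP => mk; case: ltnP => ml km lm.
  + exact: (pregrowth_inj P').
  + by move=> h; case: (eN k).
  + by move=> h; case: (eN l).
  + by move=> _; apply/eqP; rewrite eqn_leq (leq_trans km) ?(leq_trans lm).
Qed.

Lemma pregrowth_growth (H : hypergraph) m (E : nat -> {set H}) (p : nat -> H) : supertree H ->
  #|edges H| = m -> pregrowth m E p -> growth m E p.
Proof.
move=> [con acyc] mH P; have [eE att inj] := P.
have eqE : edges H = [set E k | k : 'I_m].
  apply/eqP; rewrite eq_sym eqEcard; apply/andP; split.
    by apply/subsetP => _ /imsetP[k _ ->]; exact: eE.
  rewrite card_imset ?card_ord ?mH // => k l kl; apply/val_inj; exact: inj kl.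
split=> //; first by move=> k km; exact: (pregrowth_attachE acyc P km).
apply: (connected_closed (x := p 0)) => //; first by apply/grownP; left.
by move=> e y; rewrite eqE => /imsetP[k _ ->] _ _; exact: sub_grown.
Qed.

Lemma growth_pregrowth r (H : hypergraph) m (E : nat -> {set H}) (p : nat -> H) : 2 <= r -> uniform r H ->
  growth m E p -> pregrowth m E p.
Proof.
move=> r2 Hr G; split.
- exact: (growth_memE G).
- by move=> k km; rewrite (growth_attach G) // set11.
- exact: (growth_inj G r2 Hr).
Qed.

Lemma walk_end_edge (H : hypergraph) (x : H) s : walk x s -> s != [::] ->
  exists2 e, e \in unzip1 s & walk_end x s \in e.
Proof.
elim: s x => //= -[e y] s IH x /and4P[_ _ ye ws] _.
have [->|/(IH y ws)[f fs h]] := eqVneq s [::]; first by exists e; rewrite ?inE.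
by exists f; rewrite ?inE ?fs ?orbT.
Qed.

Lemma walk_start_edge (H : hypergraph) (x : H) s : walk x s -> s != [::] ->
  exists2 e, e \in unzip1 s & x \in e.
Proof.
by case: s => //= -[e y] s /and4P[_ xe _ _] _; exists e; rewrite ?inE ?eqxx.
Qed.

(** * Hypergraphs with a growth are supertrees *)

Section GrowthTree.
Variables (r : nat) (H : hypergraph) (m : nat) (E : nat -> {set H}) (p : nat -> H).
Hypothesis r2 : 2 <= r.
Hypothesis Hr : uniform r H.
Hypothesis G : growth m E p.

Lemma growth_reach (x y : H) : exists n, reach n x y.
Proof.
have P := growth_pregrowth r2 Hr G.
have rr (v : H) : reach m (p 0) v.
  apply: (reach_sub (subxx (edges H))); apply: (grown_reach P (leqnn m) (growth_memE G)).
  by rewrite (growth_cover G) inE.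
exists (m + m); apply: reach_trans (rr y); exact/reach_sym/rr.
Qed.

Lemma growth_connected : connected_hg H.
Proof.
move=> x y; have [n /reach_path[s [ps es _]]] := growth_reach x y.
by exists s.
Qed.

Lemma growth_linear : linear_hg H.
Proof.
move=> e f /(growth_memP G)[k km ->] /(growth_memP G)[l lm ->].
wlog kl : k l km lm / k <= l => [W|] kl'.
  case: (leqP k l) => [|/ltnW] kl; first exact: W.
  by rewrite setIC; apply: W => //; rewrite eq_sym.
move: kl; rewrite leq_eqVlt => /orP[/eqP kl|kl]; first by rewrite kl eqxx in kl'.
rewrite setIC -(cards1 (p l)) -(growth_attach G lm); apply: subset_leq_card.
exact: setIS (sub_grown _ _ kl).
Qed.

Lemma growth_acyclic (x : H) s : ~~ is_cycle x s.
Proof.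
apply/negP => /and5P[ws /eqP es ss us2 us1].
(* Take the edge of the cycle with the largest index [l]. All other edges of the cycle come earlier,
   so both vertices joining [E l] to the rest of the cycle lie in the union before [E l], and both
   equal [p l]. *)
have [l [lm ls lmax]] : exists l, [/\ l < m, E l \in unzip1 s &
    forall e, e \in unzip1 s -> exists2 k, k <= l & e = E k].
  have eH := walk_edges ws.
  have ex : exists l, (l < m) && (E l \in unzip1 s).
    case: s ss eH {ws es us2 us1} => //= -[e y] s _ eH.
    have [k km ek] := growth_memP G (eH e (mem_head _ _)).
    by exists k; rewrite km -ek mem_head.
  have bd l : (l < m) && (E l \in unzip1 s) -> l <= m by case/andP => /ltnW.
  case: (ex_maxnP ex bd) => l /andP[lm ls] mx; exists l; split=> // e es'.
  have [k km ek] := growth_memP G (eH e es'); exists k => //.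
  by apply: mx; rewrite km -ek.
have [y [s1 [s2 sE]]] : exists y s1 s2, s = s1 ++ (E l, y) :: s2.
  move: ls {lmax}; elim: (s) => //= -[e y] t IH; rewrite inE => /orP[/eqP->|/IH[z [s1 [s2 ->]]]].
    by exists y, [::], t.
  by exists z, ((e, y) :: s1), s2.
move: ws es ss us2 us1 lmax; rewrite sE walk_cat walk_end_cat size_cat /= => /and5P[ws1 _ zE yE ws2].
rewrite /unzip1 /unzip2 !map_cat /= !cat_uniq /= -/(unzip1 s1) -/(unzip2 s1) -/(unzip1 s2) -/(unzip2 s2).
rewrite !negb_or -!andbA => es ss /and5P[_ y1 d2 y2 _] /and5P[_ e1 _ e2 _] lmax.
set z := walk_end x s1 in zE es.
have es2 : walk_end y s2 = x by [].
have inU u e : e \in unzip1 s1 ++ unzip1 s2 -> u \in e -> u \in grown (p 0) E l.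
  rewrite mem_cat => eI ue.
  have [|k kl ek] := lmax e; first by rewrite mem_cat inE; case/orP: eI => ->; rewrite ?orbT.
  apply/grownP; right; exists k; last by rewrite -ek.
  rewrite ltn_neqAle kl andbT; apply/eqP => kl'; move: eI; rewrite ek kl'.
  by rewrite (negPf e1) (negPf e2).
(* If no edge precedes [E l], the vertex before it is the base point [x], listed only as the final
   entry; the repetition then shows up in [s2] instead of [s1]. *)
have [s1e|s1n] := eqVneq s1 [::].
  have s2n : s2 != [::] by case: (s2) ss; rewrite s1e.
  have zx : z = x by rewrite /z s1e.
  have [e ee ye] := walk_start_edge ws2 s2n.
  have [f ff xf] := walk_end_edge ws2 s2n.
  have yU : y \in grown (p 0) E l by apply: inU ye; rewrite mem_cat ee orbT.
  have zU : z \in grown (p 0) E l by apply: inU (f) _ _; rewrite ?mem_cat ?ff ?orbT // zx -es2.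
  have yz : y = z by rewrite (growth_attachE G lm yE yU) (growth_attachE G lm zE zU).
  case/negP: y2; rewrite yz zx -es2 /walk_end.
  by case: (s2) s2n => //= a t _; rewrite mem_last.
have [f ff zf] := walk_end_edge ws1 s1n.
have zU : z \in grown (p 0) E l by apply: inU zf; rewrite mem_cat ff.
have yU : y \in grown (p 0) E l.
  have [s2e|s2n] := eqVneq s2 [::].
    have yx : y = x by rewrite -es2 s2e.
    have [e ee xe] := walk_start_edge ws1 s1n.
    by apply: (inU y e); rewrite ?mem_cat ?ee // yx.
  have [e ee ye] := walk_start_edge ws2 s2n.
  by apply: inU ye; rewrite mem_cat ee orbT.
have yz : y = z by rewrite (growth_attachE G lm yE yU) (growth_attachE G lm zE zU).
case/negP: y1; rewrite yz /z /walk_end.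
by case: (s1) s1n => //= a t _; rewrite mem_last.
Qed.

Lemma growth_supertree : supertree H.
Proof. split; [exact: growth_connected|exact: growth_acyclic]. Qed.

End GrowthTree.

Local Open Scope ring_scope.

(** * Labels along a path *)

Fixpoint arm (R : fieldType) (al : R) (k : nat) : R :=
  if k is k'.+1 then al / (1 - arm al k') else 0.

Section Arm.
Variable R : realFieldType.
Implicit Types (al q : R) (k l : nat).

(** The interval from 0 to [q] is invariant under [b -> al / (1 - b)] once [al <= q * (1 - q)]. It
    is used with [q] equal to 1/2, 1/3 and 6/19, for [al] up to 1/4, 2/9 and 78/361. *)
Lemma arm_ge0_le al q k : 0 <= al -> q < 1 -> al <= q * (1 - q) ->
  0 <= arm al k <= q.
Proof.
move=> al0 q1 alq; elim: k => [|k /andP[b0 bq]] /=.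
  by rewrite lexx /=; nra.
have h : 0 < 1 - arm al k by rewrite subr_gt0; exact: le_lt_trans bq q1.
rewrite divr_ge0 ?(ltW h) //= ler_pdivrMr //; apply: le_trans alq _.
by apply: ler_wpM2l; lra.
Qed.

Lemma arm_bounds al k : 0 < al -> al <= 1 / 4 -> 0 <= arm al k /\ arm al k <= 1 / 2.
Proof.
by move=> al0 al4; apply/andP; apply: arm_ge0_le; lra.
Qed.

Lemma arm_rec al k : 0 < al -> al <= 1 / 4 -> arm al k.+1 * (1 - arm al k) = al.
Proof.
move=> al0 al4; rewrite /= divfK //.
by have [_ h] := arm_bounds k al0 al4; rewrite gt_eqF //; lra.
Qed.

Lemma arm_gt0 al k : 0 < al -> al <= 1 / 4 -> 0 < arm al k.+1.
Proof.
by move=> al0 al4; have [_ h] := arm_bounds k al0 al4; rewrite /= divr_gt0 //; lra.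
Qed.

(** Each gap is the previous one times [al / ((1 - arm al k.+1) * (1 - arm al k))], a positive
    factor below 1 when [al <= 1 / 4]. Monotonicity and strict concavity both follow from this. *)
Lemma arm_gap al k : 0 < al -> al <= 1 / 4 ->
  (arm al k.+2 - arm al k.+1) * ((1 - arm al k.+1) * (1 - arm al k)) =
  al * (arm al k.+1 - arm al k).
Proof.
move=> al0 al4; transitivity ((arm al k.+2 * (1 - arm al k.+1)) * (1 - arm al k)
   - (arm al k.+1 * (1 - arm al k)) * (1 - arm al k.+1)); first by ring.
by rewrite !arm_rec //; ring.
Qed.

Lemma arm_ltS al k : 0 < al -> al <= 1 / 4 -> arm al k < arm al k.+1.
Proof.
move=> al0 al4; elim: k => [|k IH]; first exact: arm_gt0.
have E := arm_gap k al0 al4.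
have [_ h1] := arm_bounds k al0 al4; have [_ h2] := arm_bounds k.+1 al0 al4.
rewrite -subr_gt0 in IH; have : 0 < al * (arm al k.+1 - arm al k) by rewrite mulr_gt0.
by rewrite -E pmulr_lgt0 ?subr_gt0 // mulr_gt0 // subr_gt0; lra.
Qed.

Lemma arm_mono al k l : 0 < al -> al <= 1 / 4 -> (k <= l)%N -> arm al k <= arm al l.
Proof.
move=> al0 al4; elim: l => [|l IH]; first by rewrite leqn0 => /eqP->.
by rewrite leq_eqVlt => /orP[/eqP->//|/IH /le_trans]; apply; exact/ltW/arm_ltS.
Qed.

Lemma arm_gap_lt al k : 0 < al -> al <= 1 / 4 ->
  arm al k.+2 - arm al k.+1 < arm al k.+1 - arm al k.
Proof.
move=> al0 al4; have E := arm_gap k al0 al4.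
have [_ h1] := arm_bounds k al0 al4; have [_ h2] := arm_bounds k.+1 al0 al4.
have l1 := arm_ltS k al0 al4; have l2 := arm_ltS k.+1 al0 al4.
move: (arm al k) (arm al k.+1) (arm al k.+2) E h1 h2 l1 l2 => x y z E h1 h2 l1 l2.
rewrite ltNge; apply/negP => h.
have lt4 : 1 / 4 < (1 - y) * (1 - x) by nra.
have : (z - y) * (1 / 4) < (z - y) * ((1 - y) * (1 - x)) by rewrite ltr_pM2l // subr_gt0.
rewrite E; nra.
Qed.

Lemma arm_concave al k l : 0 < al -> al <= 1 / 4 -> (k < l)%N ->
  arm al l.+1 - arm al l < arm al k.+1 - arm al k.
Proof.
move=> al0 al4; elim: l => // l IH; rewrite ltnS leq_eqVlt => /orP[/eqP->|/IH].
  exact: arm_gap_lt.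
exact/lt_trans/arm_gap_lt.
Qed.

Lemma arm_le al al' k : 0 < al -> al <= al' -> al' <= 1 / 4 -> arm al k <= arm al' k.
Proof.
move=> al0 le al4; have al0' := lt_le_trans al0 le.
have al4' := le_trans le al4.
elim: k => //= k IH; have [_ h] := arm_bounds k al0' al4.
have h' := le_trans IH h.
by apply: ler_pM => //; [lra|rewrite invr_ge0; lra|rewrite lef_pV2 ?posrE; lra].
Qed.

End Arm.

(** * Solving the threshold equation *)

Section Threshold.
Variable R : rcfType.

(** Numerator and denominator of [arm] as a rational function of [al]. Clearing denominators makes
    the threshold equation polynomial, so the intermediate value theorem for polynomials applies. *)
Fixpoint arm_poly k : {poly R} * {poly R} :=
  if k is k'.+1 then ('X * (arm_poly k').2, (arm_poly k').2 - (arm_poly k').1) else (0, 1).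

Lemma arm_polyE (x : R) k : 0 <= x -> x <= 1 / 4 ->
  0 < (arm_poly k).2.[x] /\ (arm_poly k).1.[x] = arm x k * (arm_poly k).2.[x].
Proof.
move=> x0 x4; elim: k => [|k [IH1 IH2]] /=; first by rewrite !hornerE; split; lra.
have /andP[b0 b2] : 0 <= arm x k <= 1 / 2 by apply: arm_ge0_le; lra.
rewrite !hornerE IH2; split; first by nra.
by field; lra.
Qed.

Lemma arm_threshold i j : (2 <= i)%N -> (2 <= j)%N ->
  exists2 al : R, 0 < al <= 1 / 4 & 2 * al + arm al i + arm al j = 1.
Proof.
move=> i2 j2.
pose P k := (arm_poly k).1; pose Q k := (arm_poly k).2.
pose W := (2%:P * 'X - 1) * Q i * Q j + P i * Q j + P j * Q i.
have WE x : 0 <= x -> x <= 1 / 4 ->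
    W.[x] = (2 * x + arm x i + arm x j - 1) * (Q i).[x] * (Q j).[x] /\
    0 < (Q i).[x] * (Q j).[x].
  move=> x0 x4; have [p1 e1] := arm_polyE i x0 x4; have [p2 e2] := arm_polyE j x0 x4.
  by rewrite !hornerE e1 e2 -/(Q i) -/(Q j); split; [ring|rewrite mulr_gt0].
have arm0 k : arm (0 : R) k = 0 by case: k => //= k; rewrite mul0r.
have [||x /andP[x0 x4]] := @poly_ivt R W 0 (1/4); first by lra.
  apply/andP; split.
    have [|-> p] := WE 0 (lexx _); first by lra.
    by rewrite !arm0 -mulrA; nra.
  have [||-> p] := WE (1/4); [lra..|].
  (* At [al = 1/4] the arm of length 2 is already 1/3, so the left side of the equation is at least
     1/2 + 2/3; here the bounds on [i] and [j] enter. *)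
  have h k : (2 <= k)%N -> 1/3 <= arm (1/4 : R) k.
    have a0 : 0 < 1/4 :> R by lra.
    move=> k2; apply: le_trans (arm_mono a0 (lexx _) k2) => /=.
    by rewrite subr0 divr1 ler_pdivlMr; lra.
  by have := h i i2; have := h j j2; rewrite -mulrA; nra.
rewrite rootE; have [-> p] := WE x x0 x4.
rewrite -mulrA mulf_eq0 (gt_eqF p) orbF => /eqP E.
exists x; last by lra.
rewrite x4 andbT lt_neqAle x0 andbT; apply/eqP => xx.
by move: E; rewrite -xx !arm0; lra.
Qed.

End Threshold.

(* A chain v_0, e_0, v_1, ..., e_(d-1), v_d: [x k] is the load put on v_k by
   the edges outside the chain, [y k] the product of the labels of the
   vertices of e_k other than v_k and v_(k+1), [c k] the total load of v_k. *)
Record chain_label (R : numDomainType) (al : R) (d : nat) (x y c : nat -> R) : Prop := {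
  chain_le1 : forall k, (k <= d)%N -> c k <= 1;
  chain_ge : forall k, (k <= d)%N -> x k <= c k;
  chain_last : c d = x d;
  chain_prod : forall k, (k < d)%N -> al <= (c k - x k) * (1 - c k.+1) * y k }.

Section ChainLabels.
Variable R : realFieldType.
Implicit Types (al D Q : R) (d i j : nat).

(** The loads are forced from both ends: before [i] by the arm starting at [v_0], from [i] on by the
    arm starting at [v_d], with the extra load [D] at [v_i]. Every edge then balances except the one
    ending at [v_i], where the two halves meet. *)
Definition star_label al D d i k : R :=
  if (k < i)%N then 1 - arm al k else arm al (d - k) + (if k == i then D else 0).

Lemma star_label_prod al D d i k : 0 < al -> al <= 1 / 4 -> (k < d)%N ->
  (star_label al D d i k - (if k == i then D else 0)) * (1 - star_label al D d i k.+1) =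
  if k.+1 == i then (1 - arm al k) * (1 - arm al (d - i) - D) else al.
Proof.
move=> al0 al4 kd; rewrite /star_label.
have dk : (d - k = (d - k.+1).+1)%N by rewrite subnSK.
have rec1 := arm_rec k al0 al4; have rec2 := arm_rec (d - k.+1) al0 al4.
case: (ltngtP k i) => ki; case: (ltngtP k.+1 i) => ki'; try lia.
- by rewrite -[RHS]rec1; ring.
- by rewrite ki' subr0 opprD addrA.
- by rewrite dk -[RHS]rec2; ring.
- by rewrite dk -[RHS]rec2; ring.
Qed.

Lemma star_label_last al D d i : (i <= d)%N ->
  star_label al D d i d = (if d == i then D else 0).
Proof. by move=> id; rewrite /star_label ltnNge id /= subnn add0r. Qed.

Lemma star_chain al D d i : 0 < al -> al <= 1 / 4 -> 0 <= D -> (i <= d)%N ->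
  arm al i + arm al (d - i) + D <= 1 ->
  chain_label al d (fun k => if k == i then D else 0) (fun=> 1) (star_label al D d i).
Proof.
move=> al0 al4 D0 id Fi; have B k := arm_bounds k al0 al4.
split.
- move=> k kd; rewrite /star_label; have [h1 h2] := B k; have [h3 h4] := B (d - k)%N.
  case: ltngtP => ki; [lra|lra|move: Fi; rewrite -ki; lra].
- move=> k kd; rewrite /star_label; have [h1 h2] := B k; have [h3 h4] := B (d - k)%N.
  case: ltngtP => ki; lra.
- exact: star_label_last.
(* By the recursion for [arm], the edge ending at [v_i] balances exactly when the two arms and [D]
   add up to 1; a smaller sum leaves slack. *)
- move=> k kd; rewrite mulr1 star_label_prod //; case: eqP => // ki.
  have [h1 h2] := B k.
  by rewrite -[leLHS](arm_rec k al0 al4) mulrC ler_wpM2l ?subr_ge0 ?ki; lra.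
Qed.

Lemma arm_third al k : 0 < al -> al <= 2 / 9 -> 0 <= arm al k /\ arm al k <= 1 / 3.
Proof. by move=> al0 al9; apply/andP; apply: arm_ge0_le; lra. Qed.

(** Here the branch sits at a vertex of edge [i] off the path. On that edge the product is at least
    2/3 * 2/3 * 5/9 = 20/81, which exceeds 2/9. *)
Lemma core_chain al D d i : 0 < al -> al <= 2 / 9 -> 0 <= D -> D <= 4 / 9 -> (i < d)%N ->
  exists c, chain_label al d (fun=> 0) (fun k => if k == i then 1 - D else 1) c.
Proof.
move=> al0 al9 D0 D1 id; have al4 : al <= 1 / 4 by lra.
have B k := arm_third k al0 al9.
exists (fun k => if (k <= i)%N then 1 - arm al k else arm al (d - k)); split.
- move=> k kd; have [h1 h2] := B k; have [h3 h4] := B (d - k)%N; case: ifP => _; lra.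
- move=> k kd; have [h1 h2] := B k; have [h3 h4] := B (d - k)%N; case: ifP => _; lra.
- by rewrite leqNgt id /= subnn.
- move=> k kd; rewrite subr0; have [h1 h2] := B k; have [h3 h4] := B (d - k.+1)%N.
  have dk : (d - k = (d - k.+1).+1)%N by rewrite subnSK.
  have rec1 := arm_rec k al0 al4; have rec2 := arm_rec (d - k.+1) al0 al4.
  case: (ltngtP k i) => ki.
  + by rewrite -[leLHS]rec1; lra.
  + by rewrite dk -[leLHS]rec2; lra.
  + have h : 4 / 9 <= (1 - arm al k) * (1 - arm al (d - k.+1)) by nra.
    by apply: (@le_trans _ _ (4 / 9 * (1 - D))); [lra|apply: ler_wpM2r; [lra|exact: h]].
Qed.

(** Two branches of load [al]: the first at [v_i] or inside edge [i], the second at [v_(j+1)] or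
    inside edge [j], according to [t1] and [t2]. Since [s] bounds from below the room left beside
    one arm and one branch, the constant load [1 - s] on the vertices after [v_i] up to [v_j] gives
    each of the edges from [i] to [j] a product of at least [s * s] or [s * (1 - s)]. *)
Lemma two_branch_chain al Q d i j (t1 t2 : bool) : 0 < al -> al <= 2 / 9 ->
  (forall k, (k < d)%N -> arm al k <= Q) ->
  let s := 1 - Q - al in al <= s * s -> al <= s * (1 - s) -> 0 <= s -> s <= 1 ->
  (i <= j)%N -> (j < d)%N ->
  exists c, chain_label al d
    (fun k => (if t1 && (k == i) then al else 0) + (if t2 && (k == j.+1) then al else 0))
    (fun k => (if ~~ t1 && (k == i) then 1 - al else 1) *
              (if ~~ t2 && (k == j) then 1 - al else 1)) c.
Proof.
move=> al0 al9 bQ s ss s1s s0 s1 ij jd; have al4 : al <= 1 / 4 by lra.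
have B k := arm_third k al0 al9.
exists (fun k => if (k <= i)%N then 1 - arm al k else if (k <= j)%N then 1 - s else
   arm al (d - k) + (if t2 && (k == j.+1) then al else 0)); split.
- move=> k kd; have [h1 h2] := B k; have [h3 h4] := B (d - k)%N.
  by case: ifP => _; [lra|case: ifP => _; [lra|case: ifP => _; lra]].
- move=> k kd; have [h1 h2] := B k; have [h3 h4] := B (d - k)%N.
  case: (leqP k i) => ki.
    have -> : k == j.+1 = false by clear -ki ij; lia.
    by rewrite andbF addr0; case: ifP => _; lra.
  have -> : k == i = false by clear -ki; lia.
  rewrite andbF add0r; case: (leqP k j) => kj; last by lra.
  have -> : k == j.+1 = false by clear -kj; lia.
  by rewrite andbF; lra.
- have -> : (d <= i)%N = false by clear -ij jd; lia.
  have -> : (d <= j)%N = false by clear -jd; lia.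
  have -> : d == i = false by clear -ij jd; lia.
  by rewrite subnn andbF.
- move=> k kd; have [h1 h2] := B k; have [h3 h4] := B (d - k.+1)%N.
  have dk : (d - k = (d - k.+1).+1)%N by rewrite subnSK.
  have rec1 := arm_rec k al0 al4; have rec2 := arm_rec (d - k.+1) al0 al4.
  have q1 := bQ k kd; have q2 : arm al (d - k.+1) <= Q by apply: bQ; rewrite ltn_subrL (leq_ltn_trans _ kd).
  set b := arm al k in h1 h2 rec1 q1 *; set b' := arm al (d - k.+1) in h3 h4 rec2 q2 *.
  (* A branch inside the edge costs the factor [1 - al], and [(1 - b) * (1 - al)] is still at least
     [1 - b - al]. *)
  have L : s <= (1 - b - (if t1 then al else 0)) * (if ~~ t1 then 1 - al else 1).
    by rewrite /s; case: (t1) => /=; [lra|nra].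
  have M : s <= (1 - b' - (if t2 then al else 0)) * (if ~~ t2 then 1 - al else 1).
    by rewrite /s; case: (t2) => /=; [lra|nra].
  move: L M; set L1 := (X in (1 - b - X)); set L2 := (X in s <= _ * X).
  move=> L; set M1 := (X in (1 - b' - X)); set M2 := (X in s <= _ * X) => M.
  case: (ltngtP k i) => ki.
  + have -> : k == j = false by clear -ki ij; lia.
    have -> : k == j.+1 = false by clear -ki ij; lia.
    by rewrite !andbF -[leLHS]rec1; lra.
  + case: (ltngtP k j) => kj.
    * have -> : k == j.+1 = false by clear -ki kj ij jd; lia.
      by rewrite !andbF; lra.
    * have -> : k.+1 == j.+1 = false by clear -ki kj ij jd; lia.
      rewrite dk -[leLHS]rec2 !andbF; lra.
    * rewrite kj eqxx.
      have -> : j == j.+1 = false by clear; lia.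
      rewrite !andbT !andbF -/M1 -/M2 addr0 subr0 mul1r.
      by apply: le_trans s1s _; rewrite mulrC -mulrA; apply: ler_wpM2l; rewrite ?subr_ge0 // opprD addrA.
  + rewrite -ki in ij *; have -> : k == j.+1 = false by clear -ij; lia.
    rewrite !andbT andbF -/L1 -/L2 addr0.
    case: (ltngtP k j) => kj; [|clear -kj ij; lia|].
    * rewrite andbF mulr1; apply: le_trans ss _.
      have -> : 1 - (1 - s) = s by lra.
      by rewrite mulrAC; apply: ler_wpM2r.
    * rewrite -kj !eqxx !andbT -/M1 -/M2 opprD addrA mulrACA; apply: le_trans ss _.
      by apply: ler_pM.
Qed.

End ChainLabels.

(** * A path with two extra edges *)

(** The path is grown from its end [v 0], which is the root, so attachment vertices and path
    vertices agree along it; the indices [d] and [d.+1] are left for the two extra edges. *)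
Record spine (H : hypergraph) (d : nat) (E : nat -> {set H}) (p v : nat -> H) : Prop := {
  spine_growth : growth d.+2 E p;
  spine_attach : forall k, (k < d)%N -> p k = v k;
  spine_next : forall k, (k < d)%N -> v k.+1 \in E k;
  spine_inj : forall k l, (k <= d)%N -> (l <= d)%N -> v k = v l -> k = l }.

Lemma prod_eq_if (R : comNzRingType) (T : finType) (A : {set T}) (w : T) (z : R) :
  \prod_(u in A) (if w == u then z else 1) = if w \in A then z else 1.
Proof.
case: ifP => [wA|wA].
  rewrite (big_setD1 w) //= eqxx big1 ?mulr1 // => u.
  by rewrite !inE eq_sym => /andP[/negPf->].
by rewrite big1 // => u uA; case: eqP => // wu; rewrite wu uA in wA.
Qed.

Lemma chain_label_ext (R : numDomainType) (al : R) d x x' y y' c :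
  (forall k, (k <= d)%N -> x' k = x k) -> (forall k, (k < d)%N -> y' k = y k) ->
  chain_label al d x y c -> chain_label al d x' y' c.
Proof.
move=> xx yy [h1 h2 h3 h4]; split=> //.
- by move=> k kd; rewrite xx // h2.
- by rewrite h3 xx.
- by move=> k kd; rewrite xx ?yy ?h4 // ltnW.
Qed.

Section Spine.
Variables (H : hypergraph) (d : nat) (E : nat -> {set H}) (p v : nat -> H).
Hypothesis d0 : (0 < d)%N.
Hypothesis S : spine d E p v.
Local Notation U := (grown (p 0%N) E).
Let G := spine_growth S.
Let lt2 k (kd : (k < d)%N) : (k < d.+2)%N := leqW (leqW kd).

Definition core k : {set H} := E k :\ v k :\ v k.+1.

Lemma spine_mem k : (k < d)%N -> v k \in E k.
Proof. by move=> kd; rewrite -(spine_attach S kd); case: (attach_mem G (lt2 kd)). Qed.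

Lemma spine_grown k : (k <= d)%N -> v k \in U k.
Proof.
case: k => [_|k kd]; first by rewrite -(spine_attach S d0) root_grown.
by apply: (subsetP (sub_grown _ E (leqnn k.+1))); exact: (spine_next S).
Qed.

(** A path vertex that precedes [E l] can only be its attachment vertex [v l]. A vertex beyond
    [v l.+1] is new in a later edge, so it cannot lie in [E l]. *)
Lemma spine_mem_inv k l : (k <= d)%N -> (l < d)%N -> v k \in E l -> (k = l \/ k = l.+1).
Proof.
move=> kd ld vE; case: (ltngtP k l) => [kl|lk|]; last by left.
  have vU : v k \in U l by apply: (subsetP (grown_mono _ E (ltnW kl))); exact: spine_grown.
  have := growth_attachE G (lt2 ld) vE vU; rewrite (spine_attach S ld).
  by move/(spine_inj S kd (ltnW ld)); left.
right; case: k kd vE lk => // k kd vE; rewrite ltnS leq_eqVlt => /orP[/eqP->//|lk].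
have vU : v k.+1 \in U k by apply: (subsetP (sub_grown _ E lk)).
have := growth_attachE G (lt2 kd) (spine_next S kd) vU; rewrite (spine_attach S kd).
by move/(spine_inj S kd (ltnW kd)) => kk; have := ltnn k; rewrite -{2}kk leqnn.
Qed.

Lemma core_spine k l : (k <= d)%N -> (l < d)%N -> v k \notin core l.
Proof.
move=> kd ld; rewrite !inE; apply/negP => /and3P[n1 n2 vE].
by case: (spine_mem_inv kd ld vE) => kl; rewrite kl eqxx in n1 n2.
Qed.

Lemma core_uniq u k l : (k < d)%N -> (l < d)%N -> u \in core k -> u \in core l -> k = l.
Proof.
move=> kd ld; rewrite !inE => /and3P[_ n1 u1] /and3P[_ n2 u2].
by apply: (parent_uniq G (lt2 kd) (lt2 ld) u1 _ u2); rewrite (spine_attach S).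
Qed.

Lemma core_grown u k : (k < d)%N -> u \in core k -> u \in U d.
Proof.
by move=> kd; rewrite !inE => /and3P[_ _ uE]; apply: (subsetP (sub_grown _ E kd)).
Qed.

Lemma grown_spineP u : u \in U d ->
  (exists2 k, (k <= d)%N & u = v k) \/ (exists2 k, (k < d)%N & u \in core k).
Proof.
case/grownP => [->|[k kd uE]]; first by left; exists 0%N; rewrite // (spine_attach S d0).
have [->|n1] := eqVneq u (v k); first by left; exists k; rewrite // ltnW.
have [->|n2] := eqVneq u (v k.+1); first by left; exists k.+1.
by right; exists k; rewrite // !inE n1 n2.
Qed.

Section Load.
Variables (R : realType) (b c : nat -> R).

Definition extra_load u : R := (if p d == u then b d else 0) + (if p d.+1 == u then b d.+1 else 0).

Hypothesis bE : forall k, (k < d)%N -> b k = c k - extra_load (v k).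
Hypothesis c_last : c d = extra_load (v d).

Lemma load_split u : load d.+2 p b u = \sum_(k < d | v k == u) b k + extra_load u.
Proof.
rewrite /load big_mkcond !big_ord_recr /= -addrA; congr (_ + _).
rewrite -big_mkcond; apply: eq_bigl => k; rewrite -(spine_attach S (ltn_ord k)) //.
Qed.

Lemma load_spine k : (k <= d)%N -> load d.+2 p b (v k) = c k.
Proof.
move=> kd; rewrite load_split; move: (kd); rewrite leq_eqVlt => /orP[/eqP kE|kd'].
  rewrite kE c_last big1 ?add0r // => l /eqP/(spine_inj S (ltnW (ltn_ord l)) (leqnn d)) h.
  by have := ltn_ord l; rewrite h ltnn.
rewrite (big_pred1 (Ordinal kd')) /=; first by rewrite bE // subrK.
move=> l /=; apply/eqP/eqP => [/(spine_inj S (ltnW (ltn_ord l)) kd) h|->//].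
exact/val_inj.
Qed.

Lemma load_off u : (forall k, (k <= d)%N -> u != v k) -> load d.+2 p b u = extra_load u.
Proof.
move=> h; rewrite load_split big1 ?add0r // => l /eqP vl.
by have := h l (ltnW (ltn_ord l)); rewrite vl eqxx.
Qed.

Lemma load_core k u : (k < d)%N -> u \in core k -> load d.+2 p b u = extra_load u.
Proof.
move=> kd uc; apply: load_off => l ld; apply: contraTneq uc => ->; exact: core_spine.
Qed.

Lemma load_new k u : (d <= k)%N -> (k < d.+2)%N -> u \in E k :\ p k ->
  load d.+2 p b u = extra_load u.
Proof.
move=> dk kd; rewrite !inE => /andP[up uE]; apply: load_off => l ld.
apply: contraNneq up => ul; apply/eqP/(growth_attachE G kd uE).
by rewrite ul; apply: (subsetP (grown_mono _ E (leq_trans ld dk))); exact: spine_grown.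
Qed.

Lemma prod_path_edge k : (k < d)%N ->
  \prod_(u in E k :\ p k) (1 - load d.+2 p b u) =
  (1 - c k.+1) * \prod_(u in core k) (1 - extra_load u).
Proof.
move=> kd; rewrite (spine_attach S kd) (big_setD1 (v k.+1)) /=.
  by rewrite load_spine //; congr (_ * _); apply: eq_bigr => u /(load_core kd) ->.
rewrite !inE (spine_next S kd) andbT; apply/eqP => /(spine_inj S kd (ltnW kd)) kk.
by have := ltnn k; rewrite -{2}kk leqnn.
Qed.

(** The second extra edge loads a new vertex of the first one exactly when it is attached outside
    the union of the path edges. *)
Lemma prod_first_extra :
  \prod_(u in E d :\ p d) (1 - load d.+2 p b u) = if p d.+1 \in U d then 1 else 1 - b d.+1.
Proof.
have dd : (d < d.+2)%N by [].
rewrite (eq_bigr (fun u => if p d.+1 == u then 1 - b d.+1 else 1)); last first.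
  move=> u ue; rewrite (load_new (leqnn d)) // /extra_load.
  move: ue; rewrite !inE eq_sym => /andP[/negPf-> _].
  by rewrite add0r; case: ifP; rewrite ?subr0.
rewrite prod_eq_if in_setD1.
have : p d.+1 \in U d :|: E d by case: (attach_mem G (ltnSn d.+1)).
rewrite in_setU; case: (boolP (p d.+1 \in U d)) => [pU _|pU /= pE].
  by case: eqP => //= np; case: ifP => // pE; rewrite (growth_attachE G dd pE pU) in np.
rewrite pE andbT; case: eqP => // pp.
by move: pU; rewrite pp; case: (attach_mem G dd) => _ ->.
Qed.

Lemma prod_second_extra :
  \prod_(u in E d.+1 :\ p d.+1) (1 - load d.+2 p b u) = 1.
Proof.
rewrite big1 // => u ue; rewrite (load_new _ (ltnSn _) ue) // /extra_load.
move: ue; rewrite !inE => /andP[ne uE]; rewrite [p d.+1 == u]eq_sym (negPf ne) addr0.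
case: eqP => [pu|]; rewrite ?subr0 //.
have uU : u \in U d.+1.
  by rewrite -pu; apply: (subsetP (grown_mono _ E (leqnSn d))); case: (attach_mem G (leqnSn d.+1)).
by rewrite (growth_attachE G (ltnSn d.+1) uE uU) eqxx in ne.
Qed.

End Load.
End Spine.

(** * Labels for the supertrees outside the ranking *)

Section SpineBound.
Variables (R : realType) (r : nat) (H : hypergraph) (d : nat).
Variables (E : nat -> {set H}) (p v : nat -> H).
Hypothesis d0 : (0 < d)%N.
Hypothesis r2 : (2 <= r)%N.
Hypothesis Hr : uniform r H.
Hypothesis S : spine d E p v.
Local Notation U := (grown (p 0%N) E).
Let G := spine_growth S.

(** Recovers the labels [b] from the total loads [c]: at [v_k] the path edge takes what the extra
    load [x k] leaves. *)
Definition spine_weight (c x : nat -> R) (D1 D2 : R) (k : nat) : R :=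
  if (k < d)%N then c k - x k else if k == d then D1 else D2.

Lemma spine_bound (a D1 D2 : R) (e : H -> R) (c : nat -> R) (lam : R[i]) :
  0 < a -> 0 <= D1 -> 0 <= D2 ->
  (forall u, e u = (if p d == u then D1 else 0) + (if p d.+1 == u then D2 else 0)) ->
  (forall u, e u <= 1) ->
  chain_label (a ^+ r) d (fun k => e (v k)) (fun k => \prod_(u in core E v k) (1 - e u)) c ->
  a ^+ r <= D1 * (if p d.+1 \in U d then 1 else 1 - D2) -> a ^+ r <= D2 ->
  is_eigenvalue r H lam -> a * ComplexField.Normc.normc lam <= 1.
Proof.
move=> a0 D1_0 D2_0 eE e1 [c1 ce cl cp] h1 h2.
pose b := spine_weight c (fun k => e (v k)) D1 D2.
have bd : b d = D1 by rewrite /b /spine_weight ltnn eqxx.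
have bd1 : b d.+1 = D2.
  by rewrite /b /spine_weight ltnNge leqnSn /= gtn_eqF.
have extra_loadE u : extra_load d p b u = e u by rewrite /extra_load bd bd1 eE.
have bE k : (k < d)%N -> b k = c k - extra_load d p b (v k).
  by move=> kd; rewrite extra_loadE /b /spine_weight kd.
have cE : c d = extra_load d p b (v d) by rewrite extra_loadE.
apply: (label_bound G r2 Hr (b := b) a0).
- move=> k _; rewrite /b /spine_weight; case: ifP => [kd|_]; last by case: ifP.
  by rewrite subr_ge0; apply: ce; exact: ltnW.
- move=> u; have [/existsP[k /eqP->]|/existsPn none] := boolP [exists k : 'I_d.+1, u == v k].
    have kd : (k <= d)%N by rewrite -ltnS.
    by rewrite (load_spine S bE cE) // c1.
  rewrite (load_off S) ?extra_loadE // => k kd.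
  by have := none (Ordinal (kd : (k < d.+1)%N)).
- move=> k; rewrite ltnS leq_eqVlt => /orP[/eqP->|].
    by rewrite (prod_second_extra d0 S) bd1 mulr1.
  rewrite ltnS leq_eqVlt => /orP[/eqP->|kd].
    by rewrite (prod_first_extra d0 S) bd bd1.
  rewrite (prod_path_edge d0 S bE cE kd) bE // extra_loadE mulrA.
  by under eq_bigr do rewrite extra_loadE; exact: cp.
Qed.

(** All extra load on the path edges sits at [p d]. The bound 4/9 covers two pendent edges there,
    [D = 2 al], as well as a branch of two successive edges, [D = al / (1 - al)]. *)
Lemma spine_single_branch (al D : R) (e : H -> R) : 0 < al -> al <= 2 / 9 -> 0 <= D -> D <= 4 / 9 ->
  (forall u, u \in U d -> e u = if p d == u then D else 0) ->
  (forall i, (i <= d)%N -> p d = v i -> arm al i + arm al (d - i) + D <= 1) ->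
  exists c, chain_label al d (fun k => e (v k)) (fun k => \prod_(u in core E v k) (1 - e u)) c.
Proof.
move=> al0 al9 D0 D1 eE armD; have al4 : al <= 1 / 4 by lra.
have yE k : (k < d)%N ->
    \prod_(u in core E v k) (1 - e u) = if p d \in core E v k then 1 - D else 1.
  move=> kd; rewrite -prod_eq_if; apply: eq_bigr => u /(core_grown p kd) uU.
  by rewrite eE //; case: ifP; rewrite ?subr0.
have xE k : (k <= d)%N -> e (v k) = if p d == v k then D else 0.
  by move=> kd; rewrite eE // (subsetP (grown_mono _ E kd)) ?(spine_grown d0 S).
have wU : p d \in U d by case: (attach_mem G (leqnSn d.+1)).
case: (grown_spineP d0 S wU) => [[i id wE]|[i id wE]].
  exists (star_label al D d i).
  apply: (chain_label_ext _ _ (star_chain al0 al4 D0 id (armD i id wE))) => k kd.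
    rewrite xE // wE eq_sym; congr (if _ then _ else _).
    by apply/eqP/eqP => [/(spine_inj S kd id)->|->].
  by rewrite yE // wE (negPf (core_spine d0 S _ _)).
have [c cP] := core_chain al0 al9 D0 D1 id.
exists c; apply: (chain_label_ext _ _ cP) => k kd.
  rewrite xE //; case: eqP => // wk; case/negP: (core_spine d0 S kd id).
  by rewrite -wk.
rewrite yE //; congr (if _ then _ else _); apply/idP/eqP => [wk|->//].
exact: (core_uniq S kd id wk wE).
Qed.

Lemma spine_two_branch_ordered (al Q : R) (w w' : H) i j (t t' : bool) (e : H -> R) :
  0 < al -> al <= 2 / 9 -> (forall k, (k < d)%N -> arm al k <= Q) ->
  let s := 1 - Q - al in al <= s * s -> al <= s * (1 - s) -> 0 <= s -> s <= 1 ->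
  w != w' -> (forall u, e u = (if w == u then al else 0) + (if w' == u then al else 0)) ->
  (i <= j)%N -> (j < d)%N ->
  (if t then w = v i else w \in core E v i) ->
  (if t' then w' = v j.+1 else w' \in core E v j) ->
  exists c, chain_label al d (fun k => e (v k)) (fun k => \prod_(u in core E v k) (1 - e u)) c.
Proof.
move=> al0 al9 bQ s ss s1s s0 s1 ww eE ij jd wi wj.
have id := leq_ltn_trans ij jd.
have [c cP] := two_branch_chain t t' al0 al9 bQ ss s1s s0 s1 ij jd.
exists c; apply: (chain_label_ext _ _ cP) => k kd.
  rewrite eE; congr (_ + _).
    case: t wi {cP} => /= wi.
      rewrite wi; congr (if _ then _ else _); rewrite eq_sym.
      by apply/eqP/eqP => [/(spine_inj S kd (ltnW id))|->].
    case: eqP => // wk; case/negP: (core_spine d0 S kd id); by rewrite -wk.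
  case: t' wj {cP} => /= wj.
    rewrite wj; congr (if _ then _ else _); rewrite eq_sym.
    by apply/eqP/eqP => [/(spine_inj S kd jd)|->].
  case: eqP => // wk; case/negP: (core_spine d0 S kd jd); by rewrite -wk.
transitivity ((if w \in core E v k then 1 - al else 1) * (if w' \in core E v k then 1 - al else 1)).
  rewrite -!prod_eq_if -big_split /=; apply: eq_bigr => u _; rewrite eE.
  case: (eqVneq w u) => [<-|_]; first by rewrite eq_sym (negPf ww); ring.
  by case: ifP => _; ring.
congr (_ * _).
  case: t wi {cP} => /= wi; first by rewrite wi (negPf (core_spine d0 S (ltnW id) kd)).
  congr (if _ then _ else _); apply/idP/eqP => [wk|->//]; exact: (core_uniq S kd id wk wi).
case: t' wj {cP} => /= wj; first by rewrite wj (negPf (core_spine d0 S jd kd)).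
congr (if _ then _ else _); apply/idP/eqP => [wk|->//]; exact: (core_uniq S kd jd wk wj).
Qed.

Lemma spine_two_branch (al Q : R) (w w' : H) (e : H -> R) :
  0 < al -> al <= 2 / 9 -> (forall k, (k < d)%N -> arm al k <= Q) ->
  let s := 1 - Q - al in al <= s * s -> al <= s * (1 - s) -> 0 <= s -> s <= 1 ->
  w != w' -> w \in U d -> w' \in U d ->
  (forall u, e u = (if w == u then al else 0) + (if w' == u then al else 0)) ->
  exists c, chain_label al d (fun k => e (v k)) (fun k => \prod_(u in core E v k) (1 - e u)) c.
Proof.
move=> al0 al9 bQ s ss s1s s0 s1 ww wU wU' eE.
have eE' u : e u = (if w' == u then al else 0) + (if w == u then al else 0).
  by rewrite eE addrC.
have ww' : w' != w by rewrite eq_sym.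
have B1 := spine_two_branch_ordered al0 al9 bQ ss s1s s0 s1 ww eE.
have B2 := spine_two_branch_ordered al0 al9 bQ ss s1s s0 s1 ww' eE'.
(* The branches are sorted along the path. A path vertex is read as the left end of its edge if it
   comes first, and as the right end of the preceding edge if it comes second. *)
case: (grown_spineP d0 S wU) => [[a ad wE]|[a ad wE]];
case: (grown_spineP d0 S wU') => [[b bd wE']|[b bd wE']].
- case: (ltngtP a b) => ab.
  + case: b bd wE' ab => // b bd wE' ab; exact: (B1 a b true true).
  + case: a ad wE ab => // a ad wE ab; exact: (B2 b a true true).
  + by rewrite wE wE' ab eqxx in ww.
- case: (leqP a b) => ab; first exact: (B1 a b true false).
  case: a ad wE ab => // a ad wE ab; exact: (B2 b a false true).
- case: (leqP b a) => ab; first exact: (B2 b a true false).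
  case: b bd wE' ab => // b bd wE' ab; exact: (B1 a b false true).
- case: (leqP a b) => ab; first exact: (B1 a b false false).
  exact: (B2 b a false false (ltnW ab)).
Qed.

Lemma offstar_bound (a Q : R) (lam : R[i]) : 0 < a -> a ^+ r <= 2 / 9 ->
  (forall k, (k < d)%N -> arm (a ^+ r) k <= Q) ->
  let s := 1 - Q - a ^+ r in a ^+ r <= s * s -> a ^+ r <= s * (1 - s) -> 0 <= s -> s <= 1 ->
  (forall i, (2 <= i)%N -> (i + 2 <= d)%N -> ~ (p d = v i /\ p d.+1 = v i)) ->
  is_eigenvalue r H lam -> a * ComplexField.Normc.normc lam <= 1.
Proof.
move=> a0; have [al alE] : {al | al = a ^+ r} by exists (a ^+ r).
have al0 : 0 < al by rewrite alE exprn_gt0.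
rewrite -alE => al9 bQ s ss s1s s0 s1 nostar eig.
have wU : p d \in U d by case: (attach_mem G (leqnSn d.+1)).
have B k := arm_third k al0 al9.
have [wU'|wU'] := boolP (p d.+1 \in U d); last first.
  (* The second extra edge hangs on a new vertex of the first, and [D] is [arm al 2], the label that
     this arm of two edges forces at [p d]. *)
  pose D := al / (1 - al).
  have D0 : 0 <= D by rewrite divr_ge0; lra.
  have D1 : D <= 2 / 7 by rewrite ler_pdivrMr; lra.
  pose e u : R := (if p d == u then D else 0) + (if p d.+1 == u then al else 0).
  have ww : p d != p d.+1 by apply: contraNneq wU' => <-.
  have [||||c cP] := @spine_single_branch al D e al0 al9; [by []|lra| | |].
  - move=> u uU; rewrite /e; have -> : p d.+1 == u = false.
      by apply: contraNF wU' => /eqP->.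
    by rewrite addr0.
  - by move=> i id _; have [_ h1] := B i; have [_ h2] := B (d - i)%N; lra.
  rewrite alE in cP; apply: (spine_bound a0 D0 (ltW al0) _ _ cP _ _ eig) => //.
  - move=> u; rewrite /e; case: (eqVneq (p d) u) => [<-|_]; last by case: ifP; lra.
    by rewrite eq_sym (negPf ww); lra.
  - by rewrite (negPf wU') -alE /D divfK // gt_eqF //; lra.
  - by rewrite -alE.
have e1 : al <= al * (if p d.+1 \in U d then 1 else 1 - al) by rewrite wU' mulr1.
pose e u : R := (if p d == u then al else 0) + (if p d.+1 == u then al else 0).
have ele u : e u <= 1 by rewrite /e; case: ifP; case: ifP; lra.
suff [c cP] : exists c, chain_label al d (fun k => e (v k))
    (fun k => \prod_(u in core E v k) (1 - e u)) c.
  rewrite alE in cP; apply: (spine_bound a0 (ltW al0) (ltW al0) _ _ cP _ _ eig) => //.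
    by rewrite -alE.
  by rewrite -alE.
have [ww|ww] := eqVneq (p d) (p d.+1); last exact: (spine_two_branch al0 al9 bQ ss s1s s0 s1 ww wU wU').
apply: (@spine_single_branch al (al + al) e al0 al9); [lra|lra| |].
  by move=> u _; rewrite /e -ww; case: ifP => _; rewrite ?addr0.
move=> i id wi; have [_ h1] := B i; have [_ h2] := B (d - i)%N.
have arm1 : arm al 1 = al by rewrite /= subr0 divr1.
have arm0 : arm al 0 = 0 by [].
(* Only the two positions nearest each end remain. There one arm is at most [al] and the other at
   most 1/3, so two branches of load [al] fit because [3 al + 1/3 <= 1]. *)
have : [|| i == 0%N, i == 1%N, i == d | i.+1 == d].
  apply/negPn/negP; rewrite !negb_or => /and4P[n0 n1 nd n1d].
  apply: (nostar i); last by rewrite -ww wi.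
    by clear -n0 n1; lia.
  by clear -id nd n1d; lia.
case/or4P => /eqP iE.
- by rewrite iE arm0; rewrite iE in h2; lra.
- by rewrite iE arm1; rewrite iE in h2; lra.
- by rewrite iE subnn arm0; rewrite iE in h1; lra.
- by rewrite -iE subSnn arm1; lra.
Qed.

End SpineBound.

(** * Spectral radius when both extra edges share a path vertex *)

Section StarEigen.
Variables (R : realType) (r : nat) (H : hypergraph) (d i : nat).
Variables (E : nat -> {set H}) (p v : nat -> H).
Hypothesis i0 : (0 < i)%N.
Hypothesis id : (i < d)%N.
Hypothesis r2 : (2 <= r)%N.
Hypothesis Hr : uniform r H.
Hypothesis S : spine d E p v.
Hypothesis pd : p d = v i.
Hypothesis pd1 : p d.+1 = v i.
Let G := spine_growth S.
Let d0 : (0 < d)%N := leq_ltn_trans (leq0n i) id.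

Lemma star_spectral_radius (a : R) : 0 < a -> a ^+ r <= 1 / 4 ->
  2 * a ^+ r + arm (a ^+ r) i + arm (a ^+ r) (d - i) = 1 ->
  is_spectral_radius r H a^-1.
Proof.
move=> a0; have [al alE] : {al | al = a ^+ r} by exists (a ^+ r).
have al0 : 0 < al by rewrite alE exprn_gt0.
rewrite -alE => al4 F; have B k := arm_bounds k al0 al4.
pose c := star_label al (al + al) d i.
pose x k : R := if k == i then al + al else 0.
pose b := spine_weight d c x al al.
have bd : b d = al by rewrite /b /spine_weight ltnn eqxx.
have bd1 : b d.+1 = al by rewrite /b /spine_weight ltnNge leqnSn /= gtn_eqF.
have extra_loadE u : extra_load d p b u = if v i == u then al + al else 0.
  by rewrite /extra_load bd bd1 pd pd1; case: ifP => _; rewrite ?addr0.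
have vi k : (k <= d)%N -> (v i == v k) = (k == i).
  move=> kd; rewrite eq_sym; apply/eqP/eqP => [/(spine_inj S kd (ltnW id))->|->//].
  by [].
have bE k : (k < d)%N -> b k = c k - extra_load d p b (v k).
  by move=> kd; rewrite extra_loadE /b /spine_weight kd vi // ltnW.
have cE : c d = extra_load d p b (v d) by rewrite extra_loadE vi // /c star_label_last // ltnW.
have rootE : p 0%N = v 0%N by rewrite (spine_attach S).
apply: (label_spectral_radius G r2 Hr (b := b) a0).
(* [0 < i] places the root on the left arm, where [arm al 0 = 0] makes its load exactly 1. *)
- by rewrite rootE (load_spine S bE cE) // /c /star_label i0 /= subr0.
- move=> u ur; have [/existsP[k /eqP uk]|/existsPn none] := boolP [exists k : 'I_d.+1, u == v k].
    have kd : (k <= d)%N by rewrite -ltnS.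
    rewrite uk (load_spine S bE cE) // /c /star_label.
    case: (ltngtP k i) => ki.
    + have k0 : (0 < k)%N by rewrite lt0n; apply: contraNneq ur => k0; rewrite uk k0 rootE.
      by rewrite -(prednK k0); have := arm_gt0 k.-1 al0 al4; lra.
    + by have [_ h] := B (d - k)%N; lra.
    + by rewrite ki; have := arm_gt0 i.-1 al0 al4; rewrite prednK //; lra.
  have off k : (k <= d)%N -> u != v k by move=> kd; exact: (none (Ordinal (kd : (k < d.+1)%N))).
  by rewrite (load_off S) // extra_loadE eq_sym (negPf (off i (ltnW id))).
- move=> k _; rewrite /b /spine_weight; case: ifP => [kd|_]; last by case: ifP.
  rewrite /c /x /star_label; have [_ h] := B k.
  have dk : (d - k = (d - k.+1).+1)%N by rewrite subnSK.
  have h2 := arm_gt0 (d - k.+1) al0 al4.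
  by case: ltngtP => _; rewrite ?dk; lra.
- rewrite -alE => k; rewrite ltnS leq_eqVlt => /orP[/eqP->|].
    by rewrite (prod_second_extra d0 S) bd1 mulr1.
  rewrite ltnS leq_eqVlt => /orP[/eqP->|kd].
    rewrite (prod_first_extra d0 S) bd bd1 pd1.
    by rewrite (subsetP (grown_mono _ E (ltnW id))) ?mulr1 // (spine_grown d0 S) // ltnW.
  rewrite (prod_path_edge d0 S bE cE kd) bE // extra_loadE mulrA vi ?(ltnW kd) //.
  rewrite big1 => [|u uc]; last first.
    rewrite extra_loadE; case: eqP => [vu|]; rewrite ?subr0 //.
    by case/negP: (core_spine d0 S (ltnW id) kd); rewrite vu.
  rewrite mulr1 star_label_prod //; case: eqP => // ki.
  (* The threshold equation is precisely the balance of the edge ending at [v_i]. *)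
  have -> : 1 - arm al (d - i) - (al + al) = arm al i by lra.
  by rewrite -ki mulrC arm_rec.
Qed.

End StarEigen.

Local Close Scope ring_scope.

(** * Diameter when both extra edges share an inner path vertex *)

Section StarMetric.
Variables (r : nat) (H : hypergraph) (d i : nat).
Variables (E : nat -> {set H}) (p v : nat -> H).
Hypothesis i0 : 0 < i.
Hypothesis id : i < d.
Hypothesis r2 : 2 <= r.
Hypothesis Hr : uniform r H.
Hypothesis S : spine d E p v.
Hypothesis pd : p d = v i.
Hypothesis pd1 : p d.+1 = v i.
Let G := spine_growth S.
Let d0 : 0 < d := leq_ltn_trans (leq0n i) id.
Local Notation U := (grown (p 0) E).

Lemma path_edge k : k < d -> E k \in edges H.
Proof. by move=> kd; apply: (growth_memE G); exact: leqW (leqW kd). Qed.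

Lemma reach_spine k l : k <= l -> l <= d -> reach (l - k) (v k) (v l).
Proof.
elim: l => [|l IH]; first by rewrite leqn0 => /eqP-> _; exact: reach_refl.
rewrite leq_eqVlt => /orP[/eqP->|kl] ld; first exact: reach_refl.
rewrite subSn // -addn1; apply: reach_trans (IH kl (ltnW ld)) _.
by apply: (reach_edge (path_edge ld)); [exact: (spine_mem S)|exact: (spine_next S)].
Qed.

Lemma vertex_edge u : exists2 k, k < d.+2 & u \in E k.
Proof.
have : u \in U d.+2 by rewrite (growth_cover G) inE.
case/grownP => [->|//]; exists 0 => //.
by rewrite (spine_attach S) //; exact: (spine_mem S).
Qed.

Lemma pendent_mem k : d <= k -> k < d.+2 -> v i \in E k.
Proof.
move=> dk kd; case: (attach_mem G kd) => + _.
case: (ltngtP k d) => [|dk'|->]; first by rewrite ltnNge dk.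
  by have -> : k = d.+1; [apply/eqP; rewrite eqn_leq dk' -ltnS kd|rewrite pd1].
by rewrite pd.
Qed.

Lemma reach_edges k l (x y : H) : k <= l -> k < d.+2 -> l < d.+2 ->
  x \in E k -> y \in E l -> reach d x y.
Proof.
move=> kl kd ld xE yE.
have eE := growth_memE G.
case: (ltnP l d) => ld'.
  have kd' := leq_ltn_trans kl ld'.
  case: (ltngtP k l) kl => // [kl _|kl _]; last first.
    by apply: reach_leq d0 _; apply: reach_edge (eE k kd) xE _; rewrite kl.
  have r1 := reach_edge (eE k kd) xE (spine_next S kd').
  have r3 := reach_edge (eE l ld) (spine_mem S ld') yE.
  apply: reach_leq (reach_trans r1 (reach_trans (reach_spine kl (ltnW ld')) r3)).
  lia.
(* A vertex of a pendent edge is reached through [v i]; since [0 < i < d], both end edges of the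
   path, and the other pendent edge, are close enough. *)
have r3 := reach_edge (eE l ld) (pendent_mem ld' ld) yE.
case: (ltnP k d) => kd'.
  case: (leqP i k) => ik.
    have r1 := reach_edge (eE k kd) xE (spine_mem S kd').
    apply: reach_leq (reach_trans r1 (reach_trans (reach_sym (reach_spine ik (ltnW kd'))) r3)).
    lia.
  have r1 := reach_edge (eE k kd) xE (spine_next S kd').
  apply: reach_leq (reach_trans r1 (reach_trans (reach_spine ik (ltnW id)) r3)).
  lia.
have r1 := reach_edge (eE k kd) xE (pendent_mem kd' kd).
apply: reach_leq (reach_trans r1 r3); lia.
Qed.

Lemma reach_all (x y : H) : reach d x y.
Proof.
have [k kd xE] := vertex_edge x; have [l ld yE] := vertex_edge y.
case: (leqP k l) => [kl|/ltnW lk]; first exact: reach_edges kl kd ld xE yE.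
exact/reach_sym/(reach_edges lk ld kd yE xE).
Qed.

(* It varies by at most one along each edge and sends v k to k, so every path
   from v 0 to v d has length at least d. *)
Definition height u : nat := if u \in U d then \sum_(k < d) (u \notin U k) else i.

Lemma height_fresh k u : k < d -> u \in E k -> u \notin U k -> height u = k.+1.
Proof.
move=> kd uE uU; rewrite /height.
have -> : u \in U d by apply: (subsetP (sub_grown _ E kd)).
(* [u] is missing from the unions with index 0 to [k] and belongs to all later ones, which gives
   [k.+1] terms equal to 1. *)
rewrite (eq_bigr (fun l : 'I_d => l <= k : nat)) => [|l _].
  rewrite -(@big_mkord _ _ _ d xpredT (fun l => l <= k : nat)) (@big_cat_nat _ _ _ k.+1) //=.
  rewrite (@eq_big_nat _ _ _ _ _ _ (fun=> 1)) => [|l /andP[_]]; last by rewrite ltnS => ->.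
  rewrite sum_nat_const_nat subn0 muln1 big_nat_cond big1 ?addn0 // => l /andP[/andP[kl _] _].
  by rewrite leqNgt kl.
congr nat_of_bool; case: (leqP l k) => lk.
  by apply: contra uU; apply: (subsetP (grown_mono _ E lk)).
by apply/negPn; apply: (subsetP (sub_grown _ E lk)).
Qed.

Lemma height_spine k : k <= d -> height (v k) = k.
Proof.
case: k => [_|k kd].
  rewrite /height; have -> : v 0 = p 0 by rewrite (spine_attach S).
  by rewrite root_grown big1 // => k _; rewrite root_grown.
apply: height_fresh => //; first exact: (spine_next S).
apply/negP => /(growth_attachE G (leqW (leqW kd)) (spine_next S kd)).
rewrite (spine_attach S kd) => /(spine_inj S kd (ltnW kd)) kk.
by have := ltnn k; rewrite -{2}kk leqnn.
Qed.

Lemma height_edge e x y : e \in edges H -> x \in e -> y \in e -> height y <= (height x).+1.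
Proof.
case/(growth_memP G) => k kd -> xE yE.
case: (ltnP k d) => kd'.
  have h u : u \in E k -> height u = k \/ height u = k.+1.
    move=> uE; case: (boolP (u \in U k)) => uU; last by right; exact: height_fresh.
    left; rewrite (growth_attachE G kd uE uU) (spine_attach S kd') height_spine //.
    exact: ltnW.
  by case: (h x xE) => ->; case: (h y yE) => ->; lia.
have h u : u \in E k -> height u = i.
  move=> uE; case: (boolP (u \in U d)) => uU; last by rewrite /height (negPf uU).
  have uU' := subsetP (grown_mono _ E kd') u uU.
  have -> : u = v i.
    rewrite (growth_attachE G kd uE uU') -(growth_attachE G kd (pendent_mem kd' kd)) //.
    by apply: (subsetP (grown_mono _ E (leq_trans (ltnW id) kd'))); exact: (spine_grown d0 S (ltnW id)).
  by rewrite height_spine // ltnW.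
by rewrite !h.
Qed.

Lemma height_walk x s : walk x s -> height (walk_end x s) <= height x + size s.
Proof.
elim: s x => [|[e y] s IH] x /=; first by rewrite addn0.
move=> /and4P[eH xe ye ws]; rewrite addnS -addSn.
apply: leq_trans (IH y ws) _; rewrite leq_add2r; exact: height_edge eH xe ye.
Qed.

Lemma star_diameter : is_diameter H d.
Proof.
split.
  exists (v 0), (v d).
  have low s : is_path (v 0) s -> walk_end (v 0) s = v d -> d <= size s.
    move=> /and3P[ws _ _] es; have := height_walk ws.
    by rewrite es !height_spine.
  split=> //; have [s [ps es ss]] := reach_path (reach_all (v 0) (v d)).
  by exists s; split=> //; apply/eqP; rewrite eqn_leq ss low.
move=> x y k [_ low]; have [s [ps es ss]] := reach_path (reach_all x y).
exact: leq_trans (low s ps es) ss.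
Qed.

Lemma star_in_S : in_S d.+2 d r H.
Proof.
split=> //; [exact: growth_linear G|exact: growth_supertree r2 Hr G|exact: (growth_card G r2 Hr)|exact: star_diameter].
Qed.

End StarMetric.

(** * Isomorphisms *)

(** Both sets are enumerated with the marked element first and matched by position. The marked pair
    is what lets later edges be attached at corresponding vertices. *)
Lemma marked_bijection (T T' : finType) (A : {set T}) (A' : {set T'}) a a' :
  #|A| = #|A'| -> a \in A -> a' \in A' ->
  exists f : T -> T', [/\ f a = a', f @: A = A' & {in A &, injective f}].
Proof.
move=> cA aA aA'.
pose s := a :: enum (A :\ a); pose s' := a' :: enum (A' :\ a').
have us : uniq s by rewrite /= enum_uniq mem_enum !inE eqxx.
have us' : uniq s' by rewrite /= enum_uniq mem_enum !inE eqxx.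
have ms u : (u \in s) = (u \in A).
  by rewrite inE mem_enum !inE; case: eqP => //= ->; rewrite aA.
have ms' u : (u \in s') = (u \in A').
  by rewrite inE mem_enum !inE; case: eqP => //= ->; rewrite aA'.
have ss : size s = size s'.
  rewrite /= -!cardE; congr _.+1; apply/eqP; rewrite -(eqn_add2l 1).
  by move: cA; rewrite (cardsD1 a A) (cardsD1 a' A') aA aA' => ->.
pose f u := nth a' s' (index u s).
have ix u : u \in A -> index u s < size s' by rewrite -ss index_mem ms.
have finj : {in A &, injective f}.
  move=> u w uA wA /eqP; rewrite nth_uniq ?ix // => /eqP h.
  by rewrite -(nth_index a (_ : u \in s)) ?ms // h nth_index ?ms.
exists f; split=> //; first by rewrite /f /= eqxx.
apply/eqP; rewrite eqEcard card_in_imset // cA leqnn andbT.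
by apply/subsetP => _ /imsetP[u uA ->]; rewrite -ms' mem_nth ?ix.
Qed.

Section Isomorphism.
Variables (r m : nat) (H K : hypergraph).
Variables (E : nat -> {set H}) (p : nat -> H) (E' : nat -> {set K}) (p' : nat -> K).
Variables (t : nat -> H) (t' : nat -> K) (par : nat -> nat).
Hypothesis r2 : 2 <= r.
Hypothesis Hr : uniform r H.
Hypothesis Kr : uniform r K.
Hypothesis GH : growth m E p.
Hypothesis GK : growth m E' p'.
Hypothesis t0 : t 0 = p 0.
Hypothesis t0' : t' 0 = p' 0.
Hypothesis tS : forall k, k < m -> t k.+1 \in E k :\ p k.
Hypothesis tS' : forall k, k < m -> t' k.+1 \in E' k :\ p' k.
Hypothesis par_le : forall k, k < m -> par k <= k.
Hypothesis pE : forall k, k < m -> p k = t (par k).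
Hypothesis pE' : forall k, k < m -> p' k = t' (par k).
Local Notation U := (grown (p 0) E).
Local Notation U' := (grown (p' 0) E').

(** Edges are attached only at marks: [t 0] is the root, [t k.+1] a chosen new vertex of [E k], and
    [par k] the mark where [E k] hangs. With the same [par] on both sides, a map respecting the
    marks extends over one more edge: the image of its attachment vertex is already correct, and its
    new vertices are matched freely apart from the new mark. *)
Lemma partial_isomorphism n : n <= m -> exists f : H -> K,
  [/\ {in U n &, injective f}, f @: U n = U' n,
      forall l, l < n -> f @: E l = E' l & forall l, l <= n -> f (t l) = t' l].
Proof.
elim: n => [_|n IH nm].
  exists (fun=> t' 0); split=> //.
  - by move=> u w; rewrite !inE => /eqP-> /eqP->.
  - by rewrite imset_set1 t0'.
  - by move=> l; rewrite leqn0 => /eqP->.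
have [f [finj fU fE ft]] := IH (ltnW nm).
pose A := E n :\ p n; pose A' := E' n :\ p' n.
have cA : #|A| = #|A'|.
  apply/eqP; rewrite -(eqn_add2l 1); apply/eqP.
  have := Hr (growth_memE GH nm); have := Kr (growth_memE GK nm).
  rewrite (cardsD1 (p n) (E n)) (cardsD1 (p' n) (E' n)).
  by rewrite (attach_mem GH nm) (attach_mem GK nm) => -> ->.
have [g [ga gA ginj]] := marked_bijection cA (tS nm) (tS' nm).
have AU u : u \in A -> u \notin U n.
  by rewrite !inE => /andP[up uE]; apply: contra up => /(growth_attachE GH nm uE) ->.
have AU' u : u \in A' -> u \notin U' n.
  by rewrite !inE => /andP[up uE]; apply: contra up => /(growth_attachE GK nm uE) ->.
have UE : U n.+1 = U n :|: A.
  rewrite /= -(setD1K (attach_mem GH nm).1) setUA; congr (_ :|: _).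
  by apply/setUidPl; rewrite sub1set; case: (attach_mem GH nm).
have UE' : U' n.+1 = U' n :|: A'.
  rewrite /= -(setD1K (attach_mem GK nm).1) setUA; congr (_ :|: _).
  by apply/setUidPl; rewrite sub1set; case: (attach_mem GK nm).
pose h u := if u \in A then g u else f u.
have hA : h @: A = A'.
  by rewrite -gA; apply: eq_in_imset => u uA; rewrite /h uA.
have hU (B : {set H}) : B \subset U n -> h @: B = f @: B.
  move=> /subsetP BU; apply: eq_in_imset => u /BU uU; rewrite /h.
  by case: ifP => // /AU; rewrite uU.
have ht l : l <= n -> t l \in U n.
  move=> ln; case: l ln => [_|l ln]; first by rewrite t0 root_grown.
  have := tS (ltnW (leq_ltn_trans ln nm)); rewrite !inE => /andP[_ tE].
  exact: (subsetP (sub_grown _ E ln)).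
have hut l : l <= n -> h (t l) = t' l.
  by move=> ln; rewrite /h; case: ifP => [/AU|_]; rewrite ?ht // ft.
exists h; split.
- have gin u : u \in A -> g u \in A' by move=> uA; rewrite -gA imset_f.
  have fin u : u \in U n -> f u \in U' n by move=> uU; rewrite -fU imset_f.
  rewrite UE => u w; rewrite /h !in_setU.
  case: (boolP (u \in A)) => uA; case: (boolP (w \in A)) => wA; rewrite ?orbF.
  + by move=> _ _; exact: ginj.
  + by move=> _ /fin fw gf; have := AU' _ (gin u uA); rewrite gf fw.
  + by move=> /fin fu _ gf; have := AU' _ (gin w wA); rewrite -gf fu.
  + exact: finj.
- by rewrite UE UE' imsetU hA hU // fU.
- move=> l; rewrite ltnS leq_eqVlt => /orP[/eqP->|ln].
    rewrite -(setD1K (attach_mem GH nm).1) -(setD1K (attach_mem GK nm).1).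
    have hp : h (p n) = p' n by rewrite (pE nm) (pE' nm) hut // par_le.
    by rewrite imsetU hA imset_set1 hp.
  by rewrite hU ?fE // sub_grown.
- move=> l; rewrite leq_eqVlt => /orP[/eqP->|]; last exact: hut.
  by rewrite /h tS.
Qed.

Lemma growth_isomorphic : isomorphic H K.
Proof.
have [f [+ + fE _]] := partial_isomorphism (leqnn m).
rewrite (growth_cover GH) (growth_cover GK) => finj fT.
have fi : injective f by move=> u w; apply: finj; rewrite inE.
exists f.
  apply: inj_card_bij => //.
  by rewrite -!cardsT -fT card_imset.
move=> e; apply/idP/idP => [/(growth_memP GK)[k km eE]|/(growth_memP GH)[k km ->]].
  have -> : e = E k by apply: (imset_inj fi); rewrite eE fE.
  exact: (growth_memE GH).
by rewrite fE //; exact: (growth_memE GK).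
Qed.

End Isomorphism.

(** Path vertices serve as marks along the path; for the extra edges any new vertex will do, and
    [r >= 2] provides one. *)
Lemma spine_marks r (H : hypergraph) d (E : nat -> {set H}) p v :
  2 <= r -> uniform r H -> 0 < d -> spine d E p v ->
  exists t : nat -> H, (forall k, k <= d -> t k = v k) /\
    (forall k, k < d.+2 -> t k.+1 \in E k :\ p k).
Proof.
move=> r2 Hr d0 S; have G := spine_growth S.
exists (fun k => if k <= d then v k else odflt (v 0) [pick u in E k.-1 :\ p k.-1]); split.
  by move=> k ->.
move=> k kd; case: ifP => [kd'|_].
  rewrite !inE (spine_next S kd') andbT (spine_attach S kd').
  apply/eqP => /(spine_inj S kd' (ltnW kd')) kk; have := ltnn k; by rewrite -{2}kk leqnn.
case: pickP => [u //|none] /=.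
have := Hr _ (growth_memE G kd); rewrite (cardsD1 (p k)) (attach_mem G kd) (eq_card0 none).
by move=> r1; rewrite -r1 in r2.
Qed.

Lemma star_isomorphic r (H K : hypergraph) d i (E : nat -> {set H}) p v
    (E' : nat -> {set K}) p' v' :
  2 <= r -> uniform r H -> uniform r K -> 0 < d -> i <= d ->
  spine d E p v -> p d = v i -> p d.+1 = v i ->
  spine d E' p' v' -> p' d = v' i -> p' d.+1 = v' i -> isomorphic H K.
Proof.
move=> r2 Hr Kr d0 id S pd pd1 S' pd' pd1'.
have [t [tv tS]] := spine_marks r2 Hr d0 S; have [t' [tv' tS']] := spine_marks r2 Kr d0 S'.
(* Path edge [k] hangs at mark [k] and both extra edges at mark [i]; this common pattern is all that
   the isomorphism requires. *)
pose par k := if k < d then k else i.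
have parP k : k < d.+2 -> [/\ par k <= k, p k = t (par k) & p' k = t' (par k)].
  move=> kd; rewrite /par; case: ltnP => kd'.
    by rewrite leqnn tv ?tv' ?(spine_attach S) ?(spine_attach S') // ltnW.
  rewrite (leq_trans id kd') tv // tv' //; move: kd; rewrite ltnS leq_eqVlt => /orP[/eqP->//|].
  by rewrite ltnS => kd; have -> : k = d by apply/eqP; rewrite eqn_leq kd.
apply: (@growth_isomorphic r d.+2 H K E p E' p' t t' par) => //.
- exact: spine_growth S.
- exact: spine_growth S'.
- by rewrite tv // (spine_attach S).
- by rewrite tv' // (spine_attach S').
- by move=> k /parP[].
- by move=> k /parP[].
- by move=> k /parP[].
Qed.

(** * The supertrees of the ranking *)

(* [i] counts path vertices from 0, so the tree is attached at [i.+1]. *)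
Section TreePower.
Variables (r m d i : nat).
Hypothesis r2 : 2 <= r.
Hypothesis md : m - d = 2.
Hypothesis i0 : 0 < i.
Hypothesis id : i < d.
Local Notation G := (Ttree m d i.+1).
Local Notation P := (Tpow r m d i.+1).

Definition leaf k : 'I_(m - d) := insubd (cast_ord (esym md) ord0) k.

Definition tree_edge k : {set Tvert m d} :=
  if k < d then [set pathv m d k.+1; pathv m d k.+2] else [set pathv m d i.+1; inr (leaf (k - d))].

Lemma leafE k : k < 2 -> leaf k = k :> nat.
Proof. by move=> k2; rewrite val_insubd; case: ifP => //; rewrite {1}md k2. Qed.

Lemma pathv_eq (o : 'I_d.+1) k : k <= d -> (inl o == pathv m d k.+1) = (o == k :> nat).
Proof.
move=> kd; rewrite /pathv /=; apply/eqP/eqP => [[->]|ok]; first by rewrite inordK.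
by congr inl; apply/val_inj; rewrite /= inordK.
Qed.

Lemma inl_tree_edge (o : 'I_d.+1) k :
  (inl o \in tree_edge k) = if k < d then (o == k :> nat) || (o == k.+1 :> nat) else o == i :> nat.
Proof.
rewrite /tree_edge; case: ifP => kd; rewrite !inE.
  by rewrite !pathv_eq // ltnW.
by rewrite pathv_eq 1?ltnW // orbF.
Qed.

Lemma inr_tree_edge (q : 'I_(m - d)) k : k < d.+2 ->
  (inr q \in tree_edge k) = (d <= k) && (k == d + q).
Proof.
move=> kd; rewrite /tree_edge; case: ltnP => kd'; rewrite !inE //=.
have lk : leaf (k - d) = k - d :> nat by apply: leafE; lia.
apply/eqP/eqP => [[->]|kq]; first by lia.
by congr inr; apply/val_inj; rewrite /= lk; lia.
Qed.

Lemma tree_edge_mem e : reflect (exists2 k, k < d.+2 & e = tree_edge k) (e \in edges G).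
Proof.
apply: (iffP idP).
  rewrite inE => /orP[] /imsetP[k _ ->].
    by exists k; [exact: leqW (leqW (ltn_ord k))|rewrite /tree_edge ltn_ord].
  have k2 : k < 2 by rewrite -md.
  exists (d + k); first by lia.
  rewrite /tree_edge ltnNge leq_addr /= addKn; congr [set _; inr _].
  by apply/val_inj; rewrite /= leafE.
case=> k kd ->; rewrite inE /tree_edge; case: ltnP => kd'; apply/orP.
  by left; apply/imsetP; exists (Ordinal kd').
by right; apply/imsetP; exists (leaf (k - d)).
Qed.

Lemma tree_edge_inj k l : k < d.+2 -> l < d.+2 -> tree_edge k = tree_edge l -> k = l.
Proof.
wlog kl : k l / k <= l => [W|] kd ld te.
  by case: (leqP k l) => [h|/ltnW h]; [|symmetry]; apply: W.
move: kl; rewrite leq_eqVlt => /orP[/eqP//|kl].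
case: (ltnP l d) => ld'.
  have := inl_tree_edge (inord l.+1) l; rewrite -te inl_tree_edge ld' (ltn_trans kl ld') inordK //.
  by lia.
have := inr_tree_edge (leaf (l - d)) ld; rewrite -te inr_tree_edge // leafE; last by lia.
by lia.
Qed.

Lemma card_tree_edge k : k < d.+2 -> #|tree_edge k| = 2.
Proof.
move=> kd; rewrite /tree_edge; case: ltnP => kd'; rewrite cards2 //.
by rewrite pathv_eq // inordK; lia.
Qed.

(** Edges of the power are indexed by a subtype; this form numbers them instead, path edges first
    and the pendent edges as [d] and [d.+1], in the order that [spine] demands. *)
Definition pow_edge k : {set P} :=
  [set u : power_vert G r | match u with inl x => x \in tree_edge k | inr ej => val ej.1 == tree_edge k end].

Lemma power_edgeE (e : edge_type G) k : val e = tree_edge k -> power_edge r e = pow_edge k.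
Proof.
move=> eE; apply/setP => -[x|[e' j]]; rewrite !inE /=.
  rewrite mem_imset; last by move=> ? ? [].
  rewrite eE; case: (x \in tree_edge k) => //=.
  by apply/imsetP => -[].
rewrite -eE; apply/orP/eqP => [[/imsetP[]//|/imsetP[j' _ [-> _]]//]|/val_inj ->].
by right; apply/imsetP; exists j.
Qed.

Lemma edges_Tpow : edges P = [set pow_edge k | k : 'I_d.+2].
Proof.
apply/setP => e; apply/imsetP/imsetP => [[e' _ ->]|[k _ ->]].
  have [k kd eE] := tree_edge_mem (val e') (valP e').
  by exists (Ordinal kd) => //; exact: power_edgeE.
have te : tree_edge k \in edges G by apply/tree_edge_mem; exists k.
exists (Sub (tree_edge k) te : edge_type G) => //.
by rewrite (@power_edgeE _ k) // SubK.
Qed.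

Lemma uniform_Tpow : uniform r P.
Proof.
move=> e /imsetP[e' _ ->]; have [k kd eE] := tree_edge_mem (val e') (valP e').
rewrite /power_edge cardsU !card_imset; last 2 first.
- by move=> ? ? [].
- by move=> ? ? [].
have -> : [set inl x | x in val e'] :&: [set inr (e', j) | j : 'I_(r - 2)] = set0.
  by apply/setP => u; rewrite !inE; apply/andP => -[/imsetP[x _ ->] /imsetP[]].
by rewrite cards0 subn0 card_ord eE card_tree_edge // subnKC.
Qed.

Definition pow_vertex k : P := inl (inl (inord k)).
Definition pow_attach k : P := pow_vertex (if k < d then k else i).

Lemma spine_Tpow : spine d pow_edge pow_attach pow_vertex.
Proof.
have att0 : pow_attach 0 = pow_vertex 0 by rewrite /pow_attach (leq_ltn_trans _ id).
have vE k l : k <= d -> (pow_vertex k \in pow_edge l) =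
    if l < d then (k == l) || (k == l.+1) else k == i.
  by move=> kd; rewrite inE /= inl_tree_edge inordK.
split.
- split; first exact: edges_Tpow.
  + move=> k kd; apply/setP => u; apply/setIP/set1P => [[uE /grownP]|->].
      rewrite att0 => -[ur|[l lk ul]].
        move: uE; rewrite ur vE // /pow_attach; case: ltnP => kd'; last by lia.
        by rewrite eq_sym orbF => /eqP->.
      have ld := ltn_trans lk kd; move: uE ul; rewrite !inE; case: u => [[o|q]|[e j]] /=.
      * rewrite !inl_tree_edge => h1 h2; congr (inl (inl _)); apply/val_inj => /=.
        rewrite inordK; last by case: ifP; lia.
        by move: h1 h2; case: ltnP => kd'; case: ltnP => ld'; lia.
      * by rewrite !inr_tree_edge //; lia.
      * by move=> /eqP-> /eqP/(tree_edge_inj kd ld); lia.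
    split.
      rewrite vE /pow_attach; last by case: ifP; lia.
      by case: (k < d); rewrite eqxx.
    apply/grownP; rewrite att0 /pow_attach; case: ltnP => kd'.
      case: k kd kd' => [|k] kd kd'; first by left.
      by right; exists k => //; rewrite (vE _ _ (ltnW kd')) (ltnW kd') eqxx orbT.
    by right; exists i; [exact: leq_trans id kd'|rewrite (vE _ _ (ltnW id)) id eqxx].
  + apply/setP => u; rewrite [RHS]inE; apply/grownP; right.
    case: u => [[o|q]|[e j]].
    * case: (ltnP o d) => od; first by exists o; [lia|rewrite inE /= inl_tree_edge od eqxx].
      exists d.-1; first by lia.
      by rewrite inE /= inl_tree_edge; have := ltn_ord o; case: ifP; lia.
    * exists (d + q); first by have := ltn_ord q; lia.
      by rewrite inE /= inr_tree_edge; have := ltn_ord q; lia.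
    * have [k kd eE] := tree_edge_mem (val e) (valP e).
      by exists k => //; rewrite inE /= eE.
- by move=> k kd; rewrite /pow_attach kd.
- by move=> k kd; rewrite vE // kd eqxx orbT.
- by move=> k l kd ld [] /(congr1 val); rewrite /= !inordK.
Qed.

End TreePower.

(** * Enumerating a supertree along a given path *)

Lemma chain_spine r (H : hypergraph) d (e : nat -> {set H}) (v : nat -> H) :
  0 < r -> uniform r H -> supertree H -> #|edges H| = d.+2 -> 0 < d ->
  (forall k, k < d -> [/\ e k \in edges H, v k \in e k & v k.+1 \in e k]) ->
  (forall k l, k <= d -> l <= d -> v k = v l -> k = l) ->
  (forall k l, k < d -> l < d -> e k = e l -> k = l) ->
  exists E p, spine d E p v.
Proof.
move=> r0 Hr T cH d0 ev vinj einj.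
(* The path edges alone already form a partial enumeration, since each one after the first starts at
   a vertex of its predecessor. *)
have P : pregrowth d e v.
  split=> //; first by move=> k /ev[].
  move=> k kd; have [_ vk _] := ev k kd; rewrite inE vk /=; apply/grownP.
  case: k kd {vk} => [|k] kd; [by left|right; exists k => //].
  by have [_ _] := ev k (ltnW kd).
have ne f : f \in edges H -> f != set0.
  by move=> /Hr fr; rewrite -card_gt0 fr.
have le2 : d <= d.+2 by apply: leqW.
have [E [p [P' EE pp]]] := pregrowth_extend T.1 ne d0 le2 (eq_leq (esym cH)) P.
exists E, p; split=> //; first exact: pregrowth_growth.
by move=> k kd; rewrite EE //; have [] := ev k kd.
Qed.

Lemma path_chain (H : hypergraph) (x : H) s : is_path x s ->
  let v k := nth x (x :: unzip2 s) k in let e k := nth set0 (unzip1 s) k in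
  [/\ forall k, k < size s -> [/\ e k \in edges H, v k \in e k & v k.+1 \in e k],
      forall k l, k <= size s -> l <= size s -> v k = v l -> k = l
    & forall k l, k < size s -> l < size s -> e k = e l -> k = l].
Proof.
move=> /and3P[ws u2 u1] v e; split.
- rewrite /v /e; elim: s x ws {u1 u2 v e} => // -[f y] s IH x /= /and4P[fH xf yf ws] [|k] /=.
    by [].
  rewrite ltnS => ks; have [h1 h2 h3] := IH y ws k ks.
  have E1 : nth x (y :: unzip2 s) k = nth y (y :: unzip2 s) k.
    by apply: set_nth_default; rewrite /= size_map ltnW.
  have E2 : nth x (unzip2 s) k = nth y (unzip2 s) k.
    by apply: set_nth_default; rewrite size_map.
  by rewrite E1 E2.
- move=> k l ks ls /eqP; rewrite nth_uniq /= ?size_map // => /eqP //.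
- move=> k l ks ls /eqP; rewrite nth_uniq /= ?size_map // => /eqP //.
Qed.

(** The ranking lists attachments only up to the middle of the path. One beyond it is brought there
    by growing the path from its other end and keeping the extra edges last. *)
Lemma spine_rev r (H : hypergraph) d i (E : nat -> {set H}) p v :
  2 <= r -> uniform r H -> supertree H -> i < d ->
  spine d E p v -> p d = v i -> p d.+1 = v i ->
  exists E' p', [/\ spine d E' p' (fun k => v (d - k)), p' d = v i & p' d.+1 = v i].
Proof.
move=> r2 Hr T id S pd pd1; have G := spine_growth S.
have d0 : 0 < d by apply: leq_ltn_trans id.
pose E' k := if k < d then E (d.-1 - k) else E k.
pose p' k := if k < d then v (d - k) else v i.
have p'0 : p' 0 = v d by rewrite /p' d0 subn0.
exists E', p'; split; last 2 first.
- by rewrite /p' ltnn.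
- by rewrite /p' ltnNge leqnSn.
have lt k : k < d -> d.-1 - k < d by lia.
have sub k : k < d -> d - k = (d.-1 - k).+1 by lia.
split.
- apply: (pregrowth_growth T (growth_card G r2 Hr)); split.
  + move=> k kd; rewrite /E'; case: ltnP => kd'; apply: (growth_memE G) => //.
    exact: leqW (leqW (lt k kd')).
  + move=> k kd; rewrite inE; apply/andP; split.
      rewrite /E' /p'; case: ltnP => kd'.
        by rewrite sub //; apply: (spine_next S); exact: lt.
      case: (ltngtP k d) kd' => // [dk|->] _; last by rewrite -pd; case: (attach_mem G (leqnSn d.+1)).
      have -> : k = d.+1 by apply/eqP; rewrite eqn_leq dk -ltnS kd.
      by rewrite -pd1; case: (attach_mem G (ltnSn d.+1)).
    apply/grownP; rewrite p'0 /p'; case: ltnP => kd'.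
      case: k kd kd' => [|k] kd kd'; first by left; rewrite subn0.
      right; exists k => //; rewrite /E' (ltnW kd').
      have -> : d - k.+1 = d.-1 - k by lia.
      by apply: (spine_mem S); apply: lt; exact: ltnW.
    right; exists (d.-1 - i); first by apply: leq_trans kd'; exact: lt.
    rewrite /E' lt //; have -> : d.-1 - (d.-1 - i) = i by lia.
    exact: (spine_mem S).
  + have idx k : k < d.+2 -> exists2 k', k' < d.+2 & E' k = E k' /\ k' = if k < d then d.-1 - k else k.
      move=> kd; rewrite /E'; case: ltnP => kd'; [exists (d.-1 - k)|exists k] => //.
      exact: leqW (leqW (lt k kd')).
    move=> k l kd ld; have [k' kd' [-> kE]] := idx k kd; have [l' ld' [-> lE]] := idx l ld.
    move/(growth_inj G r2 Hr kd' ld'); rewrite kE lE.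
    by case: (ltnP k d) => h1; case: (ltnP l d) => h2; lia.
- by move=> k kd; rewrite /p' kd.
- move=> k kd; rewrite /E' kd; have -> : d - k.+1 = d.-1 - k by lia.
  by apply: (spine_mem S); exact: lt.
- move=> k l kd ld /(spine_inj S (leq_subr _ _) (leq_subr _ _)); lia.
Qed.

(** * Comparison of spectral radii *)

Local Open Scope ring_scope.

Lemma spectral_radiusE (R : realType) r (H : hypergraph) (rho : R) :
  is_spectral_radius r H rho -> spectral_radius R r H = rho.
Proof.
move=> S; apply: classical_sets.xget_unique => //= rho' [[lam eig lamE] mx'].
case: S => -[mu eig' muE] mx; apply/le_anti/andP; split; rewrite -lecR.
  by rewrite -lamE mx.
by rewrite -muE mx'.
Qed.

(** The default value 0 lies below [a^-1] too, which settles the case where [xget] finds no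
    candidate. *)
Lemma spectral_radius_le (R : realType) r (H : hypergraph) (a : R) : 0 < a ->
  (forall lam, is_eigenvalue r H lam -> a * ComplexField.Normc.normc lam <= 1) ->
  spectral_radius R r H <= a^-1.
Proof.
move=> a0 bound; rewrite /spectral_radius.
case: classical_sets.xgetP => [rho _ /= [[lam eig lamE] _]|_].
  have <- : ComplexField.Normc.normc lam = rho.
    by apply/eqP; rewrite eq_le -!lecR -lamE lexx.
  by rewrite -[a^-1]mulr1 ler_pdivlMl // bound.
by rewrite invr_ge0 ltW.
Qed.

Lemma Tpow_spectral_radius (R : realType) r m d i : (2 <= r)%N -> (m - d = 2)%N ->
  (2 <= i)%N -> (i + 2 <= d)%N ->
  exists a : R, [/\ 0 < a, a ^+ r <= 1 / 4,
    2 * a ^+ r + arm (a ^+ r) i + arm (a ^+ r) (d - i) = 1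
    & spectral_radius R r (Tpow r m d i.+1) = a^-1].
Proof.
move=> r2 md i2 id.
have i0 : (0 < i)%N by lia.
have id' : (i < d)%N by lia.
have di2 : (2 <= d - i)%N by lia.
have [al /andP[al0 al4] F] := arm_threshold R i2 di2.
have [a a0 aE] := nth_root_exists (ltnW r2) al0.
exists a; rewrite aE; split=> //.
apply: spectral_radiusE.
apply: (star_spectral_radius i0 id' r2 (uniform_Tpow (d := d) r2 md i0 id')
  (spine_Tpow r2 md i0 id')) => //; rewrite ?aE //.
- by rewrite /pow_attach ltnn.
- by rewrite /pow_attach ltnNge leqnSn.
Qed.

Lemma arm_sum_le (R : realFieldType) (al al' : R) i j : 0 < al -> al <= al' -> al' <= 1 / 4 ->
  2 * al + arm al i + arm al j <= 2 * al' + arm al' i + arm al' j.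
Proof.
move=> al0 le al4; have := arm_le i al0 le al4; have := arm_le j al0 le al4; lra.
Qed.

(* 78 / 361 = q * (1 - q) with q = 6 / 19, which keeps every arm below q.  Its
   reciprocal lies between the r-th powers of the spectral radii of the r-th
   powers of the tree T(3) with d = 5 and of a doubly infinite path with pendent
   edges at two adjacent vertices.  For d = 4, where T(3) is smaller, the larger
   al = 11 / 50 is needed, and 429 / 1400 is then arm 3. *)
Lemma offstar_threshold (R : realFieldType) d : (4 <= d)%N -> exists al Q : R,
  [/\ [/\ 0 < al, al <= 2 / 9 & forall k, (k < d)%N -> arm al k <= Q],
      let s := 1 - Q - al in [/\ al <= s * s, al <= s * (1 - s), 0 <= s & s <= 1]
    & 1 < 2 * al + arm al 2 + arm al (d - 2)].
Proof.
move=> d4; have [d4'|d5] := eqVneq d 4%N.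
  exists (11 / 50), (429 / 1400); rewrite d4'.
  have b1 : arm (11 / 50 : R) 1 = 11 / 50 by rewrite /= subr0 divr1.
  have b2 : arm (11 / 50 : R) 2 = 11 / 39.
    by rewrite -[2%N]/(1.+1)%N /= in b1 *; rewrite b1; field.
  have b3 : arm (11 / 50 : R) 3 = 429 / 1400.
    by rewrite -[arm _ 3]/(11 / 50 / (1 - arm (11 / 50) 2)) b2; field.
  split; [split; [lra|lra|]|split; lra|rewrite -[(4 - 2)%N]/2%N b2; lra].
  move=> k k4; rewrite -b3; apply: arm_mono => //; lra.
exists (78 / 361), (6 / 19).
have al0 : 0 < 78 / 361 :> R by lra.
have al4 : 78 / 361 <= 1 / 4 :> R by lra.
split; [split; [lra|lra|]|split; lra|].
  by move=> k _; have /andP[] : 0 <= arm (78 / 361 : R) k <= 6 / 19 by apply: arm_ge0_le; lra.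
have b2 : arm (78 / 361 : R) 2 = 78 / 283 by rewrite /=; field.
have b3 : 59 / 200 <= arm (78 / 361 : R) 3.
  by rewrite -[arm _ 3]/(78 / 361 / (1 - arm (78 / 361) 2)) b2 ler_pdivlMr; lra.
have d3 : (3 <= d - 2)%N by clear -d4 d5; lia.
by have := le_trans b3 (arm_mono al0 al4 d3); rewrite b2; lra.
Qed.

Lemma in_S_spine r d (H : hypergraph) : (0 < r)%N -> (0 < d)%N -> in_S d.+2 d r H ->
  exists E p v, @spine H d E p v.
Proof.
move=> r0 d0 [Hr _ T cH [[x [y [[s [ps _ sd]] _]]] _]].
have [ev vinj einj] := path_chain ps; rewrite sd in ev vinj einj.
have [E [p S]] := chain_spine r0 Hr T cH d0 ev vinj einj.
by exists E, p, (fun k => nth x (x :: unzip2 s) k).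
Qed.

Lemma Tpow_in_S r m d i : (2 <= r)%N -> m = d.+2 -> (0 < i)%N -> (i < d)%N ->
  in_S m d r (Tpow r m d i.+1).
Proof.
move=> r2 mE i0 id; have md : (m - d = 2)%N by lia.
rewrite {1}mE; apply: (star_in_S i0 id r2 (uniform_Tpow r2 md i0 id) (spine_Tpow r2 md i0 id)).
- by rewrite /pow_attach ltnn.
- by rewrite /pow_attach ltnNge leqnSn.
Qed.

Lemma spine_Tpow_isomorphic r m d i (H : hypergraph) (E : nat -> {set H}) p v :
  (2 <= r)%N -> uniform r H -> m = d.+2 -> (0 < i)%N -> (i < d)%N ->
  spine d E p v -> p d = v i -> p d.+1 = v i -> isomorphic H (Tpow r m d i.+1).
Proof.
move=> r2 Hr mE i0 id S pd pd1; have md : (m - d = 2)%N by lia.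
apply: (star_isomorphic r2 Hr (uniform_Tpow r2 md i0 id) (leq_ltn_trans (leq0n i) id) (ltnW id)
  S pd pd1 (spine_Tpow r2 md i0 id)).
- by rewrite /pow_attach ltnn.
- by rewrite /pow_attach ltnNge leqnSn.
Qed.

Lemma Tpow_radius_lt (R : realType) r m d i : (2 <= r)%N -> m = d.+2 ->
  (2 <= i)%N -> (i.+1 <= d %/ 2)%N ->
  spectral_radius R r (Tpow r m d i.+1) < spectral_radius R r (Tpow r m d i.+2).
Proof.
move=> r2 mE i2 id.
have md : (m - d = 2)%N by lia.
have id1 : (i + 2 <= d)%N by lia.
have id2 : (i.+1 + 2 <= d)%N by lia.
have [a [a0 a4 Fa ->]] := Tpow_spectral_radius R r2 md i2 id1.
have [b [b0 b4 Fb ->]] := Tpow_spectral_radius R r2 md (leqW i2) id2.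
rewrite ltf_pV2 ?posrE // -(@ltr_pXn2r _ r) ?nnegrE ?(ltW a0) ?(ltW b0) //; last exact: ltnW.
rewrite ltNge; apply/negP => ab.
have al0 : 0 < a ^+ r by rewrite exprn_gt0.
have bl0 : 0 < b ^+ r by rewrite exprn_gt0.
(* If [a ^+ r <= b ^+ r], monotonicity in [al] makes the sum for [i] at [b ^+ r] at least 1, while
   concavity makes it smaller than the sum for [i.+1], which is 1. *)
have le1 := arm_sum_le i (d - i) al0 ab b4.
have il : (i < d - i.+1)%N by lia.
have lt1 := arm_concave bl0 b4 il.
have di : (d - i = (d - i.+1).+1)%N by lia.
rewrite Fa di in le1; clear -le1 lt1 Fb; lra.
Qed.

Lemma offstar_radius_lt (R : realType) r m d (H : hypergraph) : (2 <= r)%N -> (4 <= d)%N ->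
  m = d.+2 -> in_S m d r H ->
  (forall i, (3 <= i <= d %/ 2 + 1)%N -> ~ isomorphic H (Tpow r m d i)) ->
  spectral_radius R r H < spectral_radius R r (Tpow r m d 3).
Proof.
move=> r2 d4 mE HS niso.
have md : (m - d = 2)%N by lia.
have d0 : (0 < d)%N by lia.
have r0 : (0 < r)%N by exact: ltnW.
have [E [p [v S]]] : exists E p v, @spine H d E p v.
  by apply: (in_S_spine r0 d0); rewrite -mE.
have [Hr _ T _ _] := HS.
have nostar i : (2 <= i)%N -> (i + 2 <= d)%N -> ~ (p d = v i /\ p d.+1 = v i).
  move=> i2 id [pd pd1].
  have i0 : (0 < i)%N by lia.
  have id' : (i < d)%N by lia.
  case: (leqP i (d %/ 2)) => ih.
    apply: (niso i.+1); first by rewrite ltnS i2 addn1 ltnS ih.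
    exact: spine_Tpow_isomorphic r2 Hr mE i0 id' S pd pd1.
  (* An attachment past the middle is reflected to [d - i], which belongs to the list. *)
  have [E' [p' [S' pd' pd1']]] := spine_rev r2 Hr T id' S pd pd1.
  have ii : (d - (d - i) = i)%N by lia.
  apply: (niso (d - i).+1); first by apply/andP; split; lia.
  apply: (spine_Tpow_isomorphic r2 Hr mE _ _ S'); [lia|lia|by rewrite ii|by rewrite ii].
have [al [Q [[al0 al9 bQ] [ss s1s s0 s1] F]]] := offstar_threshold R d4.
have [b b0 bE] := nth_root_exists r0 al0.
have d22 : (2 + 2 <= d)%N by [].
have [a [a0 a4 Fa ->]] := Tpow_spectral_radius R r2 md (leqnn 2) d22.
rewrite -bE in al0 al9 bQ ss s1s s0 s1 F.
have bound lam := offstar_bound d0 r2 Hr S b0 al9 bQ ss s1s s0 s1 nostar (lam := lam).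
apply: le_lt_trans (spectral_radius_le b0 bound) _.
rewrite ltf_pV2 ?posrE // -(@ltr_pXn2r _ r) ?nnegrE ?(ltW a0) ?(ltW b0) //.
rewrite ltNge; apply/negP => ab.
(* The sum for T(3) is 1 at [a ^+ r] and exceeds 1 at [b ^+ r], so by monotonicity
   [b ^+ r <= a ^+ r] is impossible. *)
have := arm_sum_le 2 (d - 2) al0 ab a4.
by rewrite Fa; apply/negP; rewrite -ltNge.
Qed.

Theorem theorem5p8 (R : realType) (r d m : nat)
    (hr : (3 <= r)%N) (hd : (4 <= d)%N) (hm : m = (d + 2)%N) :
  [/\ (forall i : nat, (3 <= i <= d %/ 2 + 1)%N -> in_S m d r (Tpow r m d i)),
      (forall i : nat, (3 <= i < d %/ 2 + 1)%N ->
         spectral_radius R r (Tpow r m d i.+1)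
           > spectral_radius R r (Tpow r m d i))
    & (forall H : hypergraph, in_S m d r H ->
         (forall i : nat, (3 <= i <= d %/ 2 + 1)%N ->
            ~ isomorphic H (Tpow r m d i)) ->
         spectral_radius R r H < spectral_radius R r (Tpow r m d 3))].
Proof.
have mE : m = d.+2 by rewrite hm addn2.
have r2 : (2 <= r)%N by exact: ltnW.
split.
- by case=> // i /andP[i3 id]; apply: Tpow_in_S => //; lia.
- by case=> // i /andP[i3 id]; apply: Tpow_radius_lt => //; lia.
- by move=> H; exact: offstar_radius_lt.
Qed.
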